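(* Let $K$ be a number field and $E/K$ an elliptic curve given by a Weierstrass equation with coefficients in $\mathcal{O}_K$, having complex multiplication by an order $\mathbb{Z}[\omega]$ of an imaginary quadratic field $F\subseteq K$. Let $\mathfrak p$ be a prime of $\mathcal O_K$. Then the group $E_0(K)$ of points of $E(K)$ with non-singular reduction modulo $\mathfrak p$ is a $\mathbb{Z}[\omega]$-submodule of $E(K)$.
   Context: Complex multiplication by $\mathbb{Z}[\omega]$ means $\mathrm{End}(E)=\mathbb{Z}[\omega]$ with all endomorphisms defined over $K$, so $E(K)$ is a $\mathbb{Z}[\omega]$-module. *)

(* Defs.v *)
From HB Require Import structures.
From mathcomp Require Import all_boot all_order all_algebra all_field.
From mathcomp Require Import generic_quotient ring_quotient.
From mathcomp Require Import boolp mpoly ring.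

Set Implicit Arguments.
Unset Strict Implicit.
Unset Printing Implicit Defensive.

Import GRing.Theory.
Local Open Scope ring_scope.
Local Open Scope quotient_scope.

(* A number field is a [K : fieldExtType rat]: a finite extension of Q. *)

Section RingOfIntegers.
Variable K : fieldExtType rat.

Definition alg_int : {pred K} :=
  fun x => `[< integralOver (intr : int -> K) x >].

Lemma alg_int_subring : subring_closed alg_int.
Proof.
split; first by apply/asboolP; exact: integral1.
- by move=> x y /asboolP hx /asboolP hy; apply/asboolP; exact: integral_sub.
- by move=> x y /asboolP hx /asboolP hy; apply/asboolP; exact: integral_mul.
Qed.

HB.instance Definition _ :=
  GRing.isSubringClosed.Build K alg_int alg_int_subring.

Record ring_of_integers :=
  RingOfIntegers { int_val :> K; _ : int_val \in alg_int }.

HB.instance Definition _ := [isSub for int_val].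
HB.instance Definition _ := [Choice of ring_of_integers by <:].
HB.instance Definition _ :=
  [SubChoice_isSubComNzRing of ring_of_integers by <:].

End RingOfIntegers.

Section Adjoin.
Variables (K : fieldExtType rat) (w : K).

Definition Zadj_pred : {pred K} :=
  fun x => `[< exists p : {poly int}, x = (map_poly intr p).[w] >].

Lemma Zadj_subring : subring_closed Zadj_pred.
Proof.
split; first by apply/asboolP; exists 1; rewrite rmorph1 hornerC.
- move=> x y /asboolP[p ->] /asboolP[q ->]; apply/asboolP.
  by exists (p - q); rewrite rmorphB !hornerE.
- move=> x y /asboolP[p ->] /asboolP[q ->]; apply/asboolP.
  by exists (p * q); rewrite rmorphM hornerM.
Qed.

HB.instance Definition _ :=
  GRing.isSubringClosed.Build K Zadj_pred Zadj_subring.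

Record Zadj := ZAdj { Zadj_val :> K; _ : Zadj_val \in Zadj_pred }.

HB.instance Definition _ := [isSub for Zadj_val].
HB.instance Definition _ := [Choice of Zadj by <:].
HB.instance Definition _ := [SubChoice_isSubComNzRing of Zadj by <:].

End Adjoin.

Definition imaginary_quadratic (K : fieldExtType rat) (F : {subfield K}) :=
  exists d : rat, exists s : K,
    [/\ (d < 0)%R, s ^+ 2 = d%:A & (F : {vspace K}) = <<1; s>>%VS].

(* An order of F: a subring that is the Z-span of a Q-basis of F. *)
Definition is_order (K : fieldExtType rat) (F : {subfield K}) (O : {pred K}) :=
  subring_closed O /\
  exists2 b : (\dim F).-tuple K, basis_of F b &
    forall x, x \in O <->
      exists c : 'I_(\dim F) -> int, x = \sum_i tnth b i *~ c i.

(* y^2 + a1 x y + a3 y = x^3 + a2 x^2 + a4 x + a6 *)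
Record weierstrass (R : Type) :=
  Weierstrass { wa1 : R; wa2 : R; wa3 : R; wa4 : R; wa6 : R }.

Definition wmap (R S : Type) (f : R -> S) (W : weierstrass R) : weierstrass S :=
  Weierstrass (f (wa1 W)) (f (wa2 W)) (f (wa3 W)) (f (wa4 W)) (f (wa6 W)).

Section Equation.
Variables (R : comNzRingType) (W : weierstrass R).
Let a1 := wa1 W. Let a2 := wa2 W. Let a3 := wa3 W.
Let a4 := wa4 W. Let a6 := wa6 W.

Definition wdisc : R :=
  let b2 := a1 ^+ 2 + 4%:R * a2 in
  let b4 := 2%:R * a4 + a1 * a3 in
  let b6 := a3 ^+ 2 + 4%:R * a6 in
  let b8 := a1 ^+ 2 * a6 + 4%:R * a2 * a6 - a1 * a3 * a4
            + a2 * a3 ^+ 2 - a4 ^+ 2 in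
  - b2 ^+ 2 * b8 - 8%:R * b4 ^+ 3 - 27%:R * b6 ^+ 2 + 9%:R * b2 * b4 * b6.

Definition weqn (x y : R) : bool :=
  y ^+ 2 + a1 * x * y + a3 * y == x ^+ 3 + a2 * x ^+ 2 + a4 * x + a6.

Definition wpoly : {mpoly R[3]} :=
  let X := 'X_(inord 0) in let Y := 'X_(inord 1) in let Z := 'X_(inord 2) in
  Y ^+ 2 * Z + a1 *: (X * Y * Z) + a3 *: (Y * Z ^+ 2)
  - X ^+ 3 - a2 *: (X ^+ 2 * Z) - a4 *: (X * Z ^+ 2) - a6 *: Z ^+ 3.

(* Homogeneous coordinates u of a point of the projective curve. *)
Definition wnonsingular (u : 'I_3 -> R) : Prop :=
  exists i, (mderiv i wpoly).@[u] != 0.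

End Equation.

(* u and v are homogeneous coordinates of the same point of the plane,
   provided one of them is nonzero. *)
Definition same_point (L : fieldType) (u v : 'I_3 -> L) : Prop :=
  exists2 c : L, c != 0 & forall i, u i = c * v i.

Section Points.
Variables (L : fieldType) (W : weierstrass L).
Let a1 := wa1 W. Let a2 := wa2 W. Let a3 := wa3 W.
Let a4 := wa4 W. Let a6 := wa6 W.

Inductive point := Inf | Aff (x y : L) of weqn W x y.

Definition hcoord (P : point) : 'I_3 -> L :=
  match P with
  | Inf => tnth [tuple 0; 1; 0]
  | Aff x y _ => tnth [tuple x; y; 1]
  end.

Definition neg_y (x y : L) := - y - a1 * x - a3.

Lemma weqn_neg x y : weqn W x y -> weqn W x (neg_y x y).
Proof.
by rewrite /weqn /neg_y /a1 /a3 => /eqP e; apply/eqP; rewrite -e; ring.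
Qed.

Definition opp_point (P : point) : point :=
  match P with
  | Inf => Inf
  | Aff x y h => Aff (weqn_neg h)
  end.

(* Slope of the chord, or of the tangent line when x1 = x2. *)
Definition slope (x1 y1 x2 y2 : L) : L :=
  if x1 == x2 then
    (3%:R * x1 ^+ 2 + 2%:R * a2 * x1 + a4 - a1 * y1)
      / (2%:R * y1 + a1 * x1 + a3)
  else (y2 - y1) / (x2 - x1).

Definition add_x (x1 y1 x2 y2 : L) : L :=
  let l := slope x1 y1 x2 y2 in l ^+ 2 + a1 * l - a2 - x1 - x2.

Definition add_y (x1 y1 x2 y2 : L) : L :=
  let l := slope x1 y1 x2 y2 in
  let x3 := add_x x1 y1 x2 y2 in neg_y x3 (l * (x3 - x1) + y1).

Lemma weqn_add x1 y1 x2 y2 : weqn W x1 y1 -> weqn W x2 y2 ->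
  ~~ ((x1 == x2) && (y1 == neg_y x2 y2)) ->
  weqn W (add_x x1 y1 x2 y2) (add_y x1 y1 x2 y2).
Proof.
move=> h1 h2 h; rewrite /add_y; apply: weqn_neg; move: h1 h2 h.
rewrite /weqn /add_x /slope /neg_y -/a1 -/a2 -/a3 -/a4 -/a6.
move=> /eqP h1 /eqP h2; case: (eqVneq x1 x2) => [e|ne] /= h; apply/eqP.
  subst x2.
  have d : y1 + y2 + a1 * x1 + a3 != 0.
    apply: contraNneq h => d; apply/eqP.
    have -> : y1 = (y1 + y2 + a1 * x1 + a3) + (- y2 - a1 * x1 - a3) by ring.
    by rewrite d add0r.
  have e : y1 = y2.
    have /eqP : (y1 - y2) * (y1 + y2 + a1 * x1 + a3) = 0.
      have -> : (y1 - y2) * (y1 + y2 + a1 * x1 + a3)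
        = (y1 ^+ 2 + a1 * x1 * y1 + a3 * y1)
          - (y2 ^+ 2 + a1 * x1 * y2 + a3 * y2) by ring.
      by rewrite h1 h2 subrr.
    by rewrite mulf_eq0 (negPf d) orbF subr_eq0 => /eqP.
  subst y2.
  have d2 : 2%:R * y1 + a1 * x1 + a3 != 0.
    by have -> : 2%:R * y1 + a1 * x1 + a3 = y1 + y1 + a1 * x1 + a3 by ring.
  set l := _ / _.
  have hl : l * (2%:R * y1 + a1 * x1 + a3)
     = 3%:R * x1 ^+ 2 + 2%:R * a2 * x1 + a4 - a1 * y1 by rewrite divfK.
  have e6 : a6 = y1 ^+ 2 + a1 * x1 * y1 + a3 * y1
     - (x1 ^+ 3 + a2 * x1 ^+ 2 + a4 * x1) by rewrite h1; ring.
  have e4 : a4 = l * (2%:R * y1 + a1 * x1 + a3)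
     - (3%:R * x1 ^+ 2 + 2%:R * a2 * x1 - a1 * y1) by rewrite hl; ring.
  by rewrite e6 e4; ring.
have dx : x2 - x1 != 0 by rewrite subr_eq0 eq_sym.
set l := _ / _.
have hl : y2 = l * (x2 - x1) + y1 by rewrite divfK // subrK.
have e6 : a6 = y1 ^+ 2 + a1 * x1 * y1 + a3 * y1
   - (x1 ^+ 3 + a2 * x1 ^+ 2 + a4 * x1) by rewrite h1; ring.
have e4 : a4 = l * (y1 + y2 + a1 * x2 + a3) + a1 * y1
   - (x1 ^+ 2 + x1 * x2 + x2 ^+ 2 + a2 * (x1 + x2)).
  apply: (mulfI dx).
  have -> : (x2 - x1) * a4
    = (y2 ^+ 2 + a1 * x2 * y2 + a3 * y2) - (y1 ^+ 2 + a1 * x1 * y1 + a3 * y1)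
      - ((x2 ^+ 3 - x1 ^+ 3) + a2 * (x2 ^+ 2 - x1 ^+ 2)).
    by rewrite h1 h2; ring.
  by rewrite hl; ring.
by rewrite e6 e4 hl; ring.
Qed.

Definition add_point (P Q : point) : point :=
  match P, Q with
  | Inf, _ => Q
  | _, Inf => P
  | Aff x1 y1 h1, Aff x2 y2 h2 =>
      match boolP ((x1 == x2) && (y1 == neg_y x2 y2)) with
      | AltTrue _ => Inf
      | AltFalse h => Aff (weqn_add h1 h2 h)
      end
  end.

End Points.

Arguments Inf {L W}.

Section BaseChange.
Variables (K L : fieldType) (j : {rmorphism K -> L}) (W : weierstrass K).

Lemma weqn_map x y : weqn W x y -> weqn (wmap j W) (j x) (j y).
Proof.
by rewrite /weqn /= -!rmorphXn -!rmorphM -!rmorphD => /eqP ->.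
Qed.

Definition base_change (P : point W) : point (wmap j W) :=
  match P with
  | Inf => Inf
  | Aff x y h => Aff (weqn_map h)
  end.

End BaseChange.

(* phi is a morphism of varieties defined over k: around every point it is
   given by homogeneous polynomials over k of the same degree.  On an
   irreducible curve, equality near P is equality wherever the polynomials do
   not all vanish.  To be used with L algebraically closed. *)
Definition morphism_over (k L : fieldType) (j : {rmorphism k -> L})
    (W : weierstrass L) (phi : point W -> point W) : Prop :=
  forall P : point W, exists d : nat, exists f : 'I_3 -> {mpoly k[3]},
    let ev (Q : point W) i := (map_mpoly j (f i)).@[hcoord Q] in
    [/\ forall i, f i \is d.-homog,
        exists i, ev P i != 0
      & forall Q, (exists i, ev Q i != 0) ->
          same_point (ev Q) (hcoord (phi Q))].

Definition endomorphism_over (k L : fieldType) (j : {rmorphism k -> L})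
    (W : weierstrass L) (phi : point W -> point W) : Prop :=
  [/\ morphism_over j phi, phi Inf = Inf
    & {morph phi : P Q / add_point P Q}].

(* theta is an isomorphism from the ring A onto the ring of endomorphisms of
   the curve over the algebraically closed field L, all of them being defined
   over k. *)
Definition is_endomorphism_ring (k L : fieldType) (j : {rmorphism k -> L})
    (W : weierstrass L) (A : nzRingType)
    (theta : A -> point W -> point W) : Prop :=
  [/\ forall a, endomorphism_over j (theta a),
      forall phi, endomorphism_over (idfun : {rmorphism L -> L}) phi ->
        exists a, theta a =1 phi
    & forall a b, theta a =1 theta b -> a = b] /\
  [/\ forall P, theta 1 P = P,
      forall a b P, theta (a + b) P = add_point (theta a P) (theta b P)
    & forall a b P, theta (a * b) P = theta a (theta b P)].

Section Reduction.
Variables (K : fieldExtType rat).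
Local Notation OK := (ring_of_integers K).
Variables (W : weierstrass OK) (p : prime_idealr OK).

Definition curve_of : weierstrass K := wmap (@int_val K) W.

(* Coordinates in O_K, not all in p, exist for every point: clear from a
   primitive representative over the localization O_(K,p) its denominators,
   which lie outside p. *)
Definition nonsingular_reduction (P : point curve_of) : Prop :=
  exists X : 'I_3 -> OK,
    [/\ exists i, X i \notin p,
        same_point (fun i => int_val (X i)) (hcoord P)
      & wnonsingular (wmap \pi_({ideal_quot p}) W)
                     (fun i => \pi_({ideal_quot p}) (X i))].

End Reduction.

(* The action of A on E(L) through theta restricts to E(K), and N is a
   submodule of E(K). *)
Definition is_submodule (K L : fieldType) (j : {rmorphism K -> L})
    (W : weierstrass K) (A : nzRingType)
    (theta : A -> point (wmap j W) -> point (wmap j W))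
    (N : point W -> Prop) : Prop :=
  [/\ N Inf,
      forall P Q, N P -> N Q -> N (add_point P Q),
      forall P, N P -> N (opp_point P)
    & forall a P, N P ->
        exists2 Q, base_change j Q = theta a (base_change j P) & N Q].

(* Main.v *)
From HB Require Import structures.
Require Import Defs.
From mathcomp Require Import all_boot all_order all_algebra all_field.
From mathcomp Require Import ring_quotient generic_quotient.
From mathcomp Require Import boolp mpoly ring.
From mathcomp Require classical_sets.

(* Extend the p-adic valuation of K to a valuation ring O of Kbar, with maximal
   ideal m.  Let E0 and E1 be the points of E(Kbar) with non-singular reduction
   and the kernel of reduction; both are subgroups.  It suffices to treat g with
   g + h = t and h g = n, where t and n are integers.  If h maps E0 into E1 then
   g = t - h preserves E0.  Otherwise pick R in E0 with h R outside E1, and let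
   r = x(R).  Write x o g = A / B with A monic and deg B < deg A.  Above a root
   of A - r B lie points P with g P = R or -R, so that n P = h g P is outside E1
   and hence so is P: the roots are integral and A - r B has coefficients in O.
   Let s be the abscissa of a point of singular reduction, and let P in E0 have
   an abscissa x in O not congruent to a root of A - s B; then (A - s B)(x) is
   not in m.  If g P had singular reduction, x(g P) - s would be in m and
   x(g P) - r would not, so B(x) = (A - r B)(x) / (x(g P) - r) would be in O and
   (A - s B)(x) = B(x) (x(g P) - s) in m, which is absurd.  So g maps E0 into E0
   generically, and then everywhere by translation: g P = g (P + Q) - g Q. *)

Set Implicit Arguments.
Unset Strict Implicit.
Unset Printing Implicit Defensive.

Import GRing.Theory.
Local Open Scope ring_scope.

(** For [g = w] with [w ^+ 2 = t w - n], the companion is [h = t - w], and sums and products of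
    endomorphisms preserving E0 preserve it again. The valuation is extended to [Kbar] because the
    fibre of [g] above [R], and the points that avoid given residue classes, are usually not
    rational over [K]. The inequality deg B < deg A expresses that [g] fixes infinity. It makes
    every [A - r B] monic, and this is used twice: integral roots give integral values at integral
    points, and a value at a point congruent to no root is a product of factors outside the maximal
    ideal. Of the associativity of addition only [(P + Q) - Q = P] is needed. *)

Ltac in_ring := repeat first [assumption | lazymatch goal with
  | |- is_true (_ - _ \in _) => apply: rpredB
  | |- is_true (_ + _ \in _) => apply: rpredD
  | |- is_true (- _ \in _) => rewrite rpredN
  | |- is_true (_%:R \in _) => apply: rpred_nat
  | |- is_true (_ * _ \in _) => apply: rpredM
  | |- is_true (_ ^+ _ \in _) => apply: rpredX
  | |- is_true (1 \in _) => apply: rpred1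
  | |- is_true (0 \in _) => apply: rpred0
  end].

(** * Valuation rings and their maximal ideals *)

Section ValuationRing.
Variables (L : fieldType) (O : subringClosed L).
Hypothesis Oval : forall x, x \in O \/ x^-1 \in O.

(** The non-units of [O]. Zero is listed apart because its inverse is 0 by convention, which lies in
    [O]. *)
Definition maxid : {pred L} :=
  fun x => (x \in O) && ((x == 0) || (x^-1 \notin O)).

Lemma maxidE x : (x \in maxid) = (x \in O) && ((x == 0) || (x^-1 \notin O)).
Proof. by []. Qed.

Lemma maxid_int x : x \in maxid -> x \in O.
Proof. by case/andP. Qed.

Lemma maxid0 : 0 \in maxid.
Proof. by rewrite maxidE rpred0 eqxx. Qed.

Lemma maxid1 : 1 \notin maxid.
Proof. by rewrite maxidE rpred1 oner_eq0 invr1 rpred1. Qed.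

Lemma notin_maxid x : x \in O -> x \notin maxid -> x != 0 /\ x^-1 \in O.
Proof.
by move=> xO; rewrite maxidE xO negb_or negbK /= => /andP[].
Qed.

Lemma notin_int x : x \notin O -> x != 0 /\ x^-1 \in maxid.
Proof.
move=> xO; have x0 : x != 0 by apply: contraNneq xO => ->; rewrite rpred0.
split=> //; have [/(negP xO)//|xV] := Oval x.
by rewrite maxidE xV invr_eq0 (negPf x0) invrK.
Qed.

(** Here [x] may lie outside [O]: not being in [maxid] means having valuation at most 0, and it is
    used in this sense throughout. *)
Lemma unit_int x : x \notin maxid -> x != 0 /\ x^-1 \in O.
Proof.
case: (boolP (x \in O)) => [|xO _]; first exact: notin_maxid.
by have [x0 /maxid_int] := notin_int xO.
Qed.

Lemma maxid_mulr x y : x \in maxid -> y \in O -> x * y \in maxid.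
Proof.
move=> /andP[xO xm] yO; rewrite maxidE rpredM //=.
have [->|x0] := eqVneq x 0; first by rewrite mul0r eqxx.
have [->|y0] := eqVneq y 0; first by rewrite mulr0 eqxx.
rewrite (negPf x0) /= in xm; rewrite mulf_eq0 (negPf x0) (negPf y0) /=.
apply: contra xm => h; have -> : x^-1 = y * (x * y)^-1 by field; rewrite x0 y0.
exact: rpredM.
Qed.

Lemma maxid_mull x y : x \in O -> y \in maxid -> x * y \in maxid.
Proof. by move=> xO ym; rewrite mulrC; apply: maxid_mulr. Qed.

Lemma maxid_opp x : x \in maxid -> - x \in maxid.
Proof. by move=> xm; rewrite -mulrN1 maxid_mulr // rpredN rpred1. Qed.

Lemma maxid_add x y : x \in maxid -> y \in maxid -> x + y \in maxid.
Proof.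
suff wl u v : u \in maxid -> v \in maxid -> v != 0 -> u / v \in O ->
    u + v \in maxid.
  move=> xm ym; have [->|x0] := eqVneq x 0; first by rewrite add0r.
  have [->|y0] := eqVneq y 0; first by rewrite addr0.
  have [h|h] := Oval (x / y); first exact: wl.
  by rewrite addrC wl // -invf_div.
move=> um vm v0 uv; have -> : u + v = v * (u / v + 1) by field.
by apply: maxid_mulr => //; rewrite rpredD ?rpred1.
Qed.

Lemma maxid_sub x y : x \in maxid -> y \in maxid -> x - y \in maxid.
Proof. by move=> xm ym; rewrite maxid_add // maxid_opp. Qed.

Lemma maxid_prime x y : x \in O -> y \in O -> x * y \in maxid ->
  x \in maxid \/ y \in maxid.
Proof.
move=> xO yO xy; case: (boolP (x \in maxid)) => [|xm]; first by left.
right; have [x0 xV] := notin_maxid xO xm.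
have -> : y = x^-1 * (x * y) by field.
exact: maxid_mull.
Qed.

Lemma maxid_sqr x : x \in O -> x ^+ 2 \in maxid -> x \in maxid.
Proof. by move=> xO; rewrite expr2 => /(maxid_prime xO xO)[]. Qed.

Lemma maxid_exp x n : x \in maxid -> x ^+ n.+1 \in maxid.
Proof.
move=> xm; rewrite exprS maxid_mulr // rpredX //; exact: maxid_int.
Qed.

Lemma maxid_unitM x y : x \notin maxid -> y \notin maxid -> x * y \notin maxid.
Proof.
move=> /unit_int[x0 xV] /unit_int[y0 yV]; apply/negP => h.
have := maxid1; have -> : 1 = x * y * (x^-1 * y^-1) by field; rewrite x0 y0.
by rewrite maxid_mulr // rpredM.
Qed.

(** If [x] were outside [O], dividing by [x ^+ 2] would put the unit [a] into the maximal ideal. *)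
Lemma int_of_quadratic a b c x : a \in O -> a \notin maxid -> b \in O ->
  c \in O -> a * x ^+ 2 = b * x + c -> x \in O.
Proof.
move=> aO am bO cO e; apply: contraT => /notin_int[x0 xV].
have := maxid_add (maxid_mull bO xV) (maxid_mull cO (maxid_exp 1 xV)).
have -> : b / x + c * x^-1 ^+ 2 = a.
  apply: (mulIf (expf_neq0 2 x0)); rewrite e; field; exact: x0.
by rewrite (negPf am).
Qed.

Lemma int_prod_XsubC (rs : seq L) x : {subset rs <= O} -> x \in O ->
  (\prod_(z <- rs) ('X - z%:P)).[x] \in O.
Proof.
move=> rsO xO; rewrite horner_prod big_seq rpred_prod // => z /rsO zO.
by rewrite !hornerE rpredB.
Qed.

Lemma unit_prod_XsubC (rs : seq L) x : {in rs, forall z, x - z \notin maxid} ->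
  (\prod_(z <- rs) ('X - z%:P)).[x] \notin maxid.
Proof.
move=> h; rewrite horner_prod big_seq.
elim/big_rec: _ => [|z y zrs ym]; first exact: maxid1.
by rewrite !hornerE maxid_unitM // h.
Qed.

End ValuationRing.

Ltac in_maxid Ov := repeat first [assumption | lazymatch goal with
  | |- is_true (_ - _ \in _) => apply: (maxid_sub Ov)
  | |- is_true (_ + _ \in _) => apply: (maxid_add Ov)
  | |- is_true (- _ \in _) => apply: maxid_opp
  | |- is_true (_ ^+ _ \in _) => apply: maxid_exp
  | |- is_true (_ * _ \in _) => first
      [ apply: maxid_mulr; [solve [in_maxid Ov] | solve [in_ring]]
      | apply: maxid_mull; [solve [in_ring] | solve [in_maxid Ov]]]
  end].

(** * Avoiding finitely many residue classes *)

Section ClosedValuation.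
Variables (L : closedFieldType) (O : subringClosed L).
Hypothesis Oval : forall x, x \in O \/ x^-1 \in O.

(* The residue field is infinite, being algebraically closed: a root of
   1 + prod (X - z) is not congruent to any z. *)
Lemma exists_avoiding (S : seq L) :
  exists2 x, x \in O & {in S, forall z, x - z \notin maxid O}.
Proof.
pose S' := [seq z <- S | z \in O].
suff [x xO hx] : exists2 x, x \in O & {in S', forall z, x - z \notin maxid O}.
  exists x => // z zS; case: (boolP (z \in O)) => zO.
    by apply: hx; rewrite mem_filter zO.
  apply: contra zO => /maxid_int h.
  have -> : z = x - (x - z) by ring.
    by rewrite rpredB.
have S'O : {subset S' <= O} by move=> z; rewrite mem_filter => /andP[].
(* For an empty list the polynomial below would be constant and could have no root. *)
move: S' S'O => [|z0 {}S] SO; first by exists 0 => //; rewrite rpred0.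
set p := \prod_(z <- z0 :: S) ('X - z%:P).
have : size (p + 1) != 1%N.
  by rewrite /p size_polyDl size_prod_XsubC ?size_poly1.
case/closed_rootP => x; rewrite /root hornerD hornerC addr_eq0 => /eqP px.
(* Otherwise [x - z0] is outside [O] and the other factors are outside the maximal ideal, so the
   product is outside [O], whereas it equals -1. *)
have xO : x \in O.
  apply: contraT => xO; have : p.[x] \notin maxid O.
    apply: (unit_prod_XsubC Oval) => z zS; apply: contra xO => /maxid_int h.
    have -> : x = (x - z) + z by ring.
    by rewrite rpredD // SO.
  have x0 : x - z0 \notin O.
    apply: contra xO => h; have -> : x = (x - z0) + z0 by ring.
    by rewrite rpredD // SO ?mem_head.
  suff : p.[x] \notin O by rewrite px rpredN rpred1.
  have {x0} [x0 xm] := notin_int Oval x0; rewrite /p big_cons hornerM !hornerE.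
  set q := \prod_(_ <- _) _; have qm : q.[x] \notin maxid O.
    apply: (unit_prod_XsubC Oval) => z zS; apply: contra xO => /maxid_int h.
    have -> : x = (x - z) + z by ring.
    by rewrite rpredD // SO // inE zS orbT.
  have [q0 qV] := unit_int Oval qm.
  apply/negP => h; have := maxid1 O.
  have -> : 1 = (x - z0) * q.[x] * (q.[x]^-1 / (x - z0)).
    by field; rewrite ?x0 ?q0.
  by rewrite maxid_mull // maxid_mull.
exists x => // z zS; apply/negP => h.
have := maxid1 O; suff : 1 \in maxid O by move->.
have -> : 1 = - p.[x] by rewrite px opprK.
apply: maxid_opp => //; rewrite /p (big_rem z) //= hornerM !hornerE.
apply: maxid_mulr => //; apply: int_prod_XsubC => // y yS.
  by apply: SO; apply: (@mem_rem _ z); exact: yS.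
Qed.

(* When the leading coefficient is not a unit it can be dropped modulo the
   maximal ideal. *)
Lemma primitive_avoiding (p : {poly L}) : (forall i, p`_i \in O) ->
  (exists i, p`_i \notin maxid O) ->
  exists S : seq L, forall x, x \in O -> {in S, forall z, x - z \notin maxid O} ->
    p.[x] \notin maxid O.
Proof.
have [n] := ubnP (size p); elim: n p => // n IH p /ltnSE sp pO [i pi].
have p0 : p != 0.
  by apply: contraNneq pi => ->; rewrite coef0 maxid0.
case: (boolP (lead_coef p \in maxid O)) => [lm|lm]; last first.
  have [rs def_p] := closed_field_poly_normal p.
  exists rs => x xO h; rewrite def_p hornerZ.
  apply: maxid_unitM => //; exact: unit_prod_XsubC.
pose q := p - lead_coef p *: 'X^((size p).-1).
have qE j : q`_j = if j == (size p).-1 then 0 else p`_j.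
  rewrite coefB coefZ coefXn; case: eqP => [->|_]; rewrite ?mulr1 ?mulr0 ?subr0 //.
  by rewrite subrr.
have sq : (size q < n)%N.
  rewrite -size_poly_gt0 in p0; apply: leq_trans sp; rewrite -(prednK p0) ltnS.
  apply/leq_sizeP => j; rewrite leq_eqVlt qE eq_sym; case: eqP => //= _.
  by rewrite prednK //; apply: nth_default.
have [||S hS] := IH q sq.
- by move=> j; rewrite qE; case: eqP => // _; apply: rpred0.
- exists i; rewrite qE; case: eqP => // e; move: lm.
  by rewrite lead_coefE -e (negPf pi).
exists S => x xO h; apply: contra (hS x xO h) => pm.
have -> : q.[x] = p.[x] - lead_coef p * x ^+ (size p).-1.
  by rewrite !hornerE.
by apply: maxid_sub => //; apply: maxid_mulr => //; apply: rpredX.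
Qed.
End ClosedValuation.

(** * The group law through lines and symmetric functions *)

Section CurveAlgebra.
Variables (L : fieldType) (W : weierstrass L).
Local Notation a1 := (wa1 W).
Local Notation a2 := (wa2 W).
Local Notation a3 := (wa3 W).
Local Notation a4 := (wa4 W).
Local Notation a6 := (wa6 W).

(* Minus the partial derivative in x, and the partial derivative in y, of
   y^2 + a1 x y + a3 y - (x^3 + a2 x^2 + a4 x + a6). *)
Definition wdx (x y : L) := 3%:R * x ^+ 2 + 2%:R * a2 * x + a4 - a1 * y.
Definition wdy (x y : L) := 2%:R * y + a1 * x + a3.

Definition wb2 := a1 ^+ 2 + 4%:R * a2.
Definition wb4 := 2%:R * a4 + a1 * a3.
Definition wb6 := a3 ^+ 2 + 4%:R * a6.
Definition wb8 := a1 ^+ 2 * a6 + 4%:R * a2 * a6 - a1 * a3 * a4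
            + a2 * a3 ^+ 2 - a4 ^+ 2.

Lemma weqn_a6 x y : weqn W x y ->
  a6 = y ^+ 2 + a1 * x * y + a3 * y - x ^+ 3 - a2 * x ^+ 2 - a4 * x.
Proof. by move=> /eqP ->; ring. Qed.

(** The equation and the two partial derivatives are solved for [a6], [a4] and [a3]; the
    discriminant then vanishes identically in what remains. *)
Lemma wdisc_singular x y : weqn W x y -> wdx x y = 0 -> wdy x y = 0 ->
  wdisc W = 0.
Proof.
move=> /weqn_a6 e hx hy; rewrite /wdisc e.
have -> : a4 = wdx x y + a1 * y - 3%:R * x ^+ 2 - 2%:R * a2 * x.
  by rewrite /wdx; ring.
have -> : a3 = wdy x y - 2%:R * y - a1 * x by rewrite /wdy; ring.
by rewrite hx hy; ring.
Qed.

(* Vieta: on the line y = l x + m the equation of the curve becomes a cubic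
   with roots x1, x2, x3. *)
Definition line_meets l m x1 x2 x3 :=
  [/\ x1 + x2 + x3 = l ^+ 2 + a1 * l - a2,
      x1 * x2 + x1 * x3 + x2 * x3 = a4 - 2%:R * l * m - a1 * m - a3 * l
    & x1 * x2 * x3 = m ^+ 2 + a3 * m - a6].

Lemma Aff_eq x y x' y' (h : weqn W x y) (h' : weqn W x' y') :
  x = x' -> y = y' -> Aff h = Aff h'.
Proof. by move=> e1 e2; subst x' y'; congr Aff; apply: bool_irrelevance. Qed.

Lemma line_of_add x1 y1 x2 y2 x3 y3 (h1 : weqn W x1 y1) (h2 : weqn W x2 y2)
    (h3 : weqn W x3 y3) : add_point (Aff h1) (Aff h2) = Aff h3 ->
  exists l m, [/\ y1 = l * x1 + m, y2 = l * x2 + m, y3 = neg_y W x3 (l * x3 + m)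
    & line_meets l m x1 x2 x3].
Proof.
rewrite /=; destruct (boolP _) as [c|c]; first by [].
case=> <- <-.
exists (slope W x1 y1 x2 y2), (y1 - slope W x1 y1 x2 y2 * x1).
(* The equation is solved for [a6] and the slope formula for [a4], after which the Vieta relations
   are polynomial identities. *)
have e1 := weqn_a6 h1; have /eqP e2 := h2.
move: c; rewrite /add_y /add_x /line_meets /slope /neg_y.
case: (eqVneq x1 x2) => [e|ne] /= c.
  subst x2.
  have d : y1 + y2 + a1 * x1 + a3 != 0.
    apply: contraNneq c => d; apply/eqP.
    have -> : y1 = (y1 + y2 + a1 * x1 + a3) + (- y2 - a1 * x1 - a3) by ring.
    by rewrite d add0r.
  have e : y2 = y1.
    have /eqP : (y2 - y1) * (y1 + y2 + a1 * x1 + a3) = 0.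
      have -> : (y2 - y1) * (y1 + y2 + a1 * x1 + a3)
        = (y2 ^+ 2 + a1 * x1 * y2 + a3 * y2)
          - (y1 ^+ 2 + a1 * x1 * y1 + a3 * y1) by ring.
      by move/eqP: h1 e2 => -> ->; rewrite subrr.
    by rewrite mulf_eq0 (negPf d) orbF subr_eq0 => /eqP.
  subst y2.
  have d2 : 2%:R * y1 + a1 * x1 + a3 != 0.
    by have -> : 2%:R * y1 + a1 * x1 + a3 = y1 + y1 + a1 * x1 + a3 by ring.
  set l := _ / _.
  have hl : l * (2%:R * y1 + a1 * x1 + a3)
     = 3%:R * x1 ^+ 2 + 2%:R * a2 * x1 + a4 - a1 * y1 by rewrite divfK.
  have e4 : a4 = l * (2%:R * y1 + a1 * x1 + a3)
     - (3%:R * x1 ^+ 2 + 2%:R * a2 * x1 - a1 * y1) by rewrite hl; ring.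
  by split; [ring|ring|ring|split; rewrite ?e1 ?e4; ring].
have dx : x2 - x1 != 0 by rewrite subr_eq0 eq_sym.
set l := _ / _.
have hl : y2 = l * (x2 - x1) + y1 by rewrite divfK // subrK.
have e4 : a4 = l * (y1 + y2 + a1 * x2 + a3) + a1 * y1
   - (x1 ^+ 2 + x1 * x2 + x2 ^+ 2 + a2 * (x1 + x2)).
  apply: (mulfI dx).
  have -> : (x2 - x1) * a4
    = (y2 ^+ 2 + a1 * x2 * y2 + a3 * y2) - (y1 ^+ 2 + a1 * x1 * y1 + a3 * y1)
      - ((x2 ^+ 3 - x1 ^+ 3) + a2 * (x2 ^+ 2 - x1 ^+ 2)).
    by rewrite e2 (eqP h1); ring.
  by rewrite hl; ring.
by split; [ring|rewrite hl; ring|ring|split; rewrite ?e1 ?e4 ?hl; ring].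
Qed.

(** Converse of [line_of_add]. When [x1 = x2], Vieta gives [wdx = l * wdy], so [wdy = 0] would make
    the point singular; the nonzero discriminant thus rules out opposite points and identifies [l]
    with the tangent slope. *)
Lemma add_of_line l m x1 y1 x2 y2 x3 (h1 : weqn W x1 y1) (h2 : weqn W x2 y2) :
  wdisc W != 0 -> y1 = l * x1 + m -> y2 = l * x2 + m ->
  line_meets l m x1 x2 x3 ->
  exists h3 : weqn W x3 (neg_y W x3 (l * x3 + m)),
    add_point (Aff h1) (Aff h2) = Aff h3.
Proof.
move=> D e1 e2 [s1 s2 s3].
have hdx : x1 = x2 -> wdx x1 y1 = l * wdy x1 y1.
  move=> e; move: s1 s2; rewrite -e => s1 s2.
  rewrite /wdx /wdy e1.
  have -> : a4 = x1 * x1 + x1 * x3 + x1 * x3 + 2%:R * l * m + a1 * m + a3 * l.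
    by rewrite s2; ring.
  have -> : a2 = l ^+ 2 + a1 * l - (x1 + x1 + x3) by rewrite s1; ring.
  by ring.
have c : ~~ ((x1 == x2) && (y1 == neg_y W x2 y2)).
  apply/negP => /andP[/eqP e /eqP]; rewrite e2 -e -e1 => ey.
  have dy : wdy x1 y1 = 0.
    have -> : wdy x1 y1 = y1 - neg_y W x1 y1 by rewrite /wdy /neg_y; ring.
    by rewrite -ey subrr.
  have dx : wdx x1 y1 = 0 by rewrite hdx // dy mulr0.
  by move/eqP: D; apply; apply: wdisc_singular h1 dx dy.
have sl : slope W x1 y1 x2 y2 = l.
  rewrite /slope; case: (eqVneq x1 x2) => [e|ne]; last first.
    have : x2 - x1 != 0 by rewrite subr_eq0 eq_sym.
    by rewrite e1 e2 => d; field.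
  have dy : wdy x1 y1 != 0.
    apply: contraNneq c => dy; rewrite e eqxx /= e2 -e -e1 -subr_eq0.
    have -> : y1 - neg_y W x1 y1 = wdy x1 y1 by rewrite /wdy /neg_y; ring.
    by rewrite dy.
  by rewrite -/(wdx x1 y1) -/(wdy x1 y1) hdx // mulfK.
have ex : add_x W x1 y1 x2 y2 = x3.
  by rewrite /add_x sl -s1; ring.
have ey : add_y W x1 y1 x2 y2 = neg_y W x3 (l * x3 + m).
  by rewrite /add_y ex sl; congr neg_y; rewrite e1; ring.
have h3 : weqn W x3 (neg_y W x3 (l * x3 + m)).
  by rewrite -ey -ex; apply: weqn_add.
exists h3; rewrite /=; destruct (boolP _) as [c'|c']; first by rewrite c' in c.
exact: Aff_eq.
Qed.

Lemma opp_inf_eq (P Q : point W) : add_point P Q = Inf -> Q = opp_point P.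
Proof.
case: P Q => [|x1 y1 h1] [|x2 y2 h2] //=.
destruct (boolP _) as [c|c]; last by [].
move=> _; case/andP: c => /eqP e /eqP ey.
by apply: Aff_eq => //; rewrite ey -e /neg_y; ring.
Qed.

Lemma add_opp_point (P : point W) : add_point P (opp_point P) = Inf.
Proof.
case: P => [|x y h] //=; destruct (boolP _) as [c|c]; first by [].
case/negP: (c); rewrite eqxx /=; apply/eqP; rewrite /neg_y; ring.
Qed.

Lemma opp_pointK : involutive (@opp_point L W).
Proof.
by case=> [|x y h] //=; apply: Aff_eq => //; rewrite /neg_y; ring.
Qed.

(** For an affine [P] the line of the addition shows that [P] is its own opposite, so that [P + P]
    is already [Inf]. *)
Lemma add_idem_inf (P : point W) : wdisc W != 0 -> add_point P P = P -> P = Inf.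
Proof.
move=> D; case: P => // x y h e.
have [l [m [e1 _ e2 _]]] := line_of_add e.
have : add_point (Aff h) (Aff h) = Inf.
  rewrite {2}(_ : Aff h = opp_point (Aff h)) ?add_opp_point //=.
  by apply: Aff_eq => //; rewrite {1}e2 e1.
by rewrite e.
Qed.

(** Negation of points carries the line [y = l x + m] to this one and fixes abscissae. The order is
    reversed to suit [add_pointK]. *)
Lemma line_meets_opp l m x1 x2 x3 : line_meets l m x1 x2 x3 ->
  line_meets (- l - a1) (- m - a3) x3 x2 x1.
Proof.
move=> [s1 s2 s3]; split.
- have -> : x3 + x2 + x1 = x1 + x2 + x3 by ring.
  by rewrite s1; ring.
- have -> : x3 * x2 + x3 * x1 + x2 * x1 = x1 * x2 + x1 * x3 + x2 * x3 by ring.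
  by rewrite s2; ring.
- have -> : x3 * x2 * x1 = x1 * x2 * x3 by ring.
  by rewrite s3; ring.
Qed.

(** Reflecting the line that computes [P + Q] gives the line that computes [(P + Q) - Q]; this is
    the one case of associativity that is used. *)
Lemma add_pointK (P Q : point W) : wdisc W != 0 ->
  add_point (add_point P Q) (opp_point Q) = P.
Proof.
move=> D; case PQ: (add_point P Q) => [|x3 y3 h3].
  by rewrite (opp_inf_eq PQ) opp_pointK; case: P {PQ}.
case: P Q PQ => [|x1 y1 h1] [|x2 y2 h2] // PQ; last first.
  have [l [m [e1 e2 e3 s]]] := line_of_add PQ.
  have [||h e] := @add_of_line (- l - a1) (- m - a3) x3 y3 x2 (neg_y W x2 y2)
    x1 h3 (weqn_neg h2) D _ _ (line_meets_opp s).
  - by rewrite e3 /neg_y; ring.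
  - by rewrite e2 /neg_y; ring.
  by rewrite [LHS]e; apply: Aff_eq => //; rewrite e1 /neg_y; ring.
by rewrite -PQ; apply: add_opp_point.
Qed.

Lemma same_abscissa x y y' (h : weqn W x y) (h' : weqn W x y') :
  Aff h' = Aff h \/ Aff h' = opp_point (Aff h).
Proof.
have /eqP : (y' - y) * (y' - neg_y W x y) = 0.
  have -> : (y' - y) * (y' - neg_y W x y) =
    (y' ^+ 2 + a1 * x * y' + a3 * y') - (y ^+ 2 + a1 * x * y + a3 * y).
    by rewrite /neg_y; ring.
  by rewrite (eqP h) (eqP h') subrr.
rewrite mulf_eq0 !subr_eq0 => /orP[] /eqP e; [left|right]; exact: Aff_eq.
Qed.

(* A symmetric relation between the abscissae of three collinear points,
   homogenized in x1 = X / Z. *)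
Definition wrel X Z x2 x3 :=
  x3 ^+ 2 * (X - x2 * Z) ^+ 2
  - x3 * (2%:R * X * x2 * (X + x2 * Z) + wb2 * X * Z * x2
          + wb4 * (X * Z + x2 * Z ^+ 2) + wb6 * Z ^+ 2)
  + (X ^+ 2 * x2 ^+ 2 - wb4 * X * Z * x2
     - wb6 * (X * Z + x2 * Z ^+ 2) - wb8 * Z ^+ 2).

Lemma wrel_homog x1 Z x2 x3 : wrel (x1 * Z) Z x2 x3 = Z ^+ 2 * wrel x1 1 x2 x3.
Proof. rewrite /wrel; ring. Qed.

(** [wrel] is the combination of the three elementary symmetric functions in which the slope and
    intercept of the line cancel. *)
Lemma wrel_add x1 y1 x2 y2 x3 y3 (h1 : weqn W x1 y1) (h2 : weqn W x2 y2)
    (h3 : weqn W x3 y3) : add_point (Aff h1) (Aff h2) = Aff h3 ->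
  wrel x1 1 x2 x3 = 0.
Proof.
move=> /line_of_add[l [m [_ _ _ [s1 s2 s3]]]].
have -> : wrel x1 1 x2 x3 = (x1 * x2 + x1 * x3 + x2 * x3) ^+ 2
  - 4%:R * (x1 + x2 + x3) * (x1 * x2 * x3) - wb2 * (x1 * x2 * x3)
  - wb4 * (x1 * x2 + x1 * x3 + x2 * x3) - wb6 * (x1 + x2 + x3) - wb8.
  by rewrite /wrel; ring.
by rewrite s1 s2 s3 /wb2 /wb4 /wb6 /wb8; ring.
Qed.

(** Expansion about the third point. Every coefficient other than that of [u ^+ 2 * v ^+ 2] is a
    combination of [wdx] and [wdy] there, hence in the maximal ideal if that point reduces to a
    singular one. *)
Lemma wrel_expand x1 x2 x3 y3 : weqn W x3 y3 ->
  let u := x1 - x3 in let v := x2 - x3 in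
  wrel x1 1 x2 x3 = u ^+ 2 * v ^+ 2
    - ((2%:R * wdx x3 y3 + a1 * wdy x3 y3) * (u * v)
       + wdy x3 y3 ^+ 2 * (u + v)
       + ((a2 + 3%:R * x3) * wdy x3 y3 ^+ 2 - a1 * wdx x3 y3 * wdy x3 y3
          - wdx x3 y3 ^+ 2)).
Proof.
move=> /weqn_a6 e u v; rewrite /u /v /wrel /wb2 /wb4 /wb6 /wb8 e /wdx /wdy; ring.
Qed.

Lemma wdx_neg x y : wdx x (neg_y W x y) = wdx x y + a1 * wdy x y.
Proof. rewrite /wdx /wdy /neg_y; ring. Qed.

Lemma wdy_neg x y : wdy x (neg_y W x y) = - wdy x y.
Proof. rewrite /wdy /neg_y; ring. Qed.

End CurveAlgebra.

(** * Non-singular reduction and the kernel of reduction are subgroups *)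

Section ValuedCurve.
Variables (L : fieldType) (O : subringClosed L).
Hypothesis Oval : forall x, x \in O \/ x^-1 \in O.
Variable W : weierstrass L.
Local Notation a1 := (wa1 W).
Local Notation a2 := (wa2 W).
Local Notation a3 := (wa3 W).
Local Notation a4 := (wa4 W).
Local Notation a6 := (wa6 W).
Hypotheses (a1O : a1 \in O) (a2O : a2 \in O) (a3O : a3 \in O) (a4O : a4 \in O)
  (a6O : a6 \in O).

(** Integrality of [y] follows from that of [x] by [int_ordinate]. A point with [x] outside [O]
    reduces to infinity, which is non-singular. *)
Definition singular_red (x y : L) :=
  [&& x \in O, wdx W x y \in maxid O & wdy W x y \in maxid O].

Definition nonsing (P : point W) :=
  if P is Aff x y _ then ~~ singular_red x y else true.

Definition in_kernel (P : point W) := if P is Aff x _ _ then x \notin O else true.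

Lemma nonsing_kernel P : in_kernel P -> nonsing P.
Proof. by case: P => //= x y _; rewrite /singular_red => /negPf ->. Qed.

Lemma int_ordinate x y : weqn W x y -> x \in O -> y \in O.
Proof.
move=> /eqP e xO.
apply: (@int_of_quadratic _ _ Oval 1 (- (a1 * x + a3))
  (x ^+ 3 + a2 * x ^+ 2 + a4 * x + a6)); rewrite ?maxid1 //; try by in_ring.
by rewrite -e; ring.
Qed.

Lemma int_wdx x y : x \in O -> y \in O -> wdx W x y \in O.
Proof. by move=> xO yO; rewrite /wdx; in_ring. Qed.

Lemma int_wdy x y : x \in O -> y \in O -> wdy W x y \in O.
Proof. by move=> xO yO; rewrite /wdy; in_ring. Qed.

Lemma int_wb : [/\ wb2 W \in O, wb4 W \in O, wb6 W \in O & wb8 W \in O].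
Proof. by split; rewrite ?/wb2 ?/wb4 ?/wb6 ?/wb8; in_ring. Qed.

(** At a singular point the linear terms vanish in the residue field, so congruent abscissae force
    [(y1 - y) ^+ 2] into the maximal ideal: both points have the same reduction. *)
Lemma singular_near x1 y1 x y : weqn W x1 y1 -> weqn W x y ->
  singular_red x y -> x1 - x \in maxid O -> singular_red x1 y1.
Proof.
move=> h1 h /and3P[xO dx dy] um; have yO := int_ordinate h xO.
have x1O : x1 \in O.
  have -> : x1 = (x1 - x) + x by ring.
  by rewrite rpredD // maxid_int.
have y1O := int_ordinate h1 x1O.
have dm : y1 - y \in maxid O.
  apply: maxid_sqr; first by rewrite rpredB.
  have -> : (y1 - y) ^+ 2 = (x1 - x) * (wdx W x y + (3%:R * x + a2) * (x1 - x)
      + (x1 - x) ^+ 2 - a1 * (y1 - y)) - wdy W x y * (y1 - y).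
    have e := weqn_a6 h; apply/eqP; rewrite -subr_eq0; apply/eqP.
    rewrite -[RHS](subrr (y1 ^+ 2 + a1 * x1 * y1 + a3 * y1)).
    by rewrite {2}(eqP h1) e /wdx /wdy; ring.
  by have ? := int_wdx xO yO; in_maxid Oval.
rewrite /singular_red x1O /=; apply/andP; split.
  have -> : wdx W x1 y1 = wdx W x y + (3%:R * (x1 + x) + 2%:R * a2) * (x1 - x)
      - a1 * (y1 - y) by rewrite /wdx; ring.
  by in_maxid Oval.
have -> : wdy W x1 y1 = wdy W x y + 2%:R * (y1 - y) + a1 * (x1 - x).
  by rewrite /wdy; ring.
by in_maxid Oval.
Qed.

(** A Weierstrass cubic has at most one singular point: the cube of the difference of the abscissae
    is a combination of the partial derivatives at the two points. *)
Lemma singular_unique x1 y1 x2 y2 : weqn W x1 y1 -> weqn W x2 y2 ->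
  singular_red x1 y1 -> singular_red x2 y2 -> x1 - x2 \in maxid O.
Proof.
move=> h1 h2 /and3P[x1O dx1 dy1] /and3P[x2O dx2 dy2].
have y1O := int_ordinate h1 x1O; have y2O := int_ordinate h2 x2O.
have h : (x1 - x2) ^+ 3 \in maxid O.
  have -> : (x1 - x2) ^+ 3 = (wdx W x1 y1 + wdx W x2 y2) * (x1 - x2)
      - (wdy W x1 y1 + wdy W x2 y2) * (y1 - y2).
    apply/eqP; rewrite -subr_eq0; apply/eqP.
    rewrite -[RHS](subrr (2%:R * (y1 ^+ 2 + a1 * x1 * y1 + a3 * y1))).
    by rewrite {2}(eqP h1) (weqn_a6 h2) /wdx /wdy; ring.
  by in_maxid Oval.
(* Passing from the cube to the fourth power allows two uses of [maxid_sqr]. *)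
have xO : x1 - x2 \in O by rewrite rpredB.
apply: maxid_sqr => //; apply: (maxid_sqr (rpredX 2 xO)).
have -> : (x1 - x2) ^+ 2 ^+ 2 = (x1 - x2) ^+ 3 * (x1 - x2) by ring.
exact: maxid_mulr.
Qed.

Lemma nonsing_opp P : nonsing P -> nonsing (opp_point P).
Proof.
case: P => //= x y h; apply: contra => /and3P[xO].
rewrite wdx_neg wdy_neg => dx dy; apply/and3P; split=> //.
  have -> : wdx W x y = (wdx W x y + a1 * wdy W x y) + a1 * - wdy W x y by ring.
  by in_maxid Oval.
by rewrite -[wdy _ _ _]opprK; apply: maxid_opp.
Qed.

Lemma kernel_opp P : in_kernel P -> in_kernel (opp_point P).
Proof. by case: P. Qed.

(** If [u] and [v] both had valuation at most 0, the left side would have smaller valuation than the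
    right. Neither is assumed integral; [wl] treats the case where one of them is. *)
Lemma maxid_biquadratic u v a b c : a \in maxid O -> b \in maxid O ->
  c \in maxid O -> u ^+ 2 * v ^+ 2 = a * (u * v) + b * (u + v) + c ->
  u \in maxid O \/ v \in maxid O.
Proof.
move=> am bm cm.
suff wl x y : x \in O -> x ^+ 2 * y ^+ 2 = a * (x * y) + b * (x + y) + c ->
    x \in maxid O \/ y \in maxid O.
  move=> e; case: (boolP (u \in O)) => uO; first exact: wl.
  case: (boolP (v \in O)) => vO.
    by apply/or_comm/wl => //; rewrite [LHS]mulrC e; ring.
  have [[u0 um] [v0 vm]] := (notin_int Oval uO, notin_int Oval vO).
  have := maxid1 O; suff -> : 1 \in maxid O by [].
  have -> : 1 = a * (u^-1 * v^-1)
      + b * (u^-1 * v^-1 * (v^-1 + u^-1)) + c * (u^-1 ^+ 2 * v^-1 ^+ 2).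
    have -> : a * (u^-1 * v^-1) + b * (u^-1 * v^-1 * (v^-1 + u^-1))
      + c * (u^-1 ^+ 2 * v^-1 ^+ 2)
      = (a * (u * v) + b * (u + v) + c) / (u ^+ 2 * v ^+ 2).
      by field; rewrite u0 v0.
    by rewrite -e divff // mulf_neq0 // expf_neq0.
  by have ? := maxid_int um; have ? := maxid_int vm; in_maxid Oval.
move=> xO e; case: (boolP (y \in O)) => yO.
  have : x ^+ 2 * y ^+ 2 \in maxid O by rewrite e; in_maxid Oval.
  by move=> /(maxid_prime (rpredX 2 xO) (rpredX 2 yO))[/maxid_sqr|/maxid_sqr];
    auto.
left; apply: maxid_sqr => //; have [y0 ym] := notin_int Oval yO.
have -> : x ^+ 2 = a * (x * y^-1) + b * (y^-1 * (x * y^-1 + 1)) + c * y^-1 ^+ 2.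
  apply: (mulIf (expf_neq0 2 y0)); rewrite e; field; exact: y0.
by have ? := maxid_int ym; in_maxid Oval.
Qed.

(** If the sum reduced to the singular point, [wrel_expand] and [maxid_biquadratic] would make one
    summand congruent to it in abscissa, hence singular as well. *)
Lemma nonsing_add P Q : nonsing P -> nonsing Q -> nonsing (add_point P Q).
Proof.
case R: (add_point P Q) => [//|x3 y3 h3].
case: P Q R => [|x1 y1 h1] [|x2 y2 h2]; try by move=> // <-.
move=> R nP nQ; apply/negP => /= s3.
have := wrel_add R; rewrite (wrel_expand _ _ h3) /= => /eqP; rewrite subr_eq0.
case/and3P: (s3) => x3O dx dy; have y3O := int_ordinate h3 x3O.
have ? := maxid_int dx; have ? := maxid_int dy.
move=> /eqP /maxid_biquadratic[]; try by in_maxid Oval.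
- by move/(singular_near h1 h3 s3); apply/negP.
- by move/(singular_near h2 h3 s3); apply/negP.
Qed.

(** If [x3] were integral, so would be the coefficients in [wrel_expand]; dividing by
    [u ^+ 2 * v ^+ 2], with [u] and [v] outside [O], would put 1 into the maximal ideal. *)
Lemma kernel_add P Q : in_kernel P -> in_kernel Q -> in_kernel (add_point P Q).
Proof.
case R: (add_point P Q) => [//|x3 y3 h3].
case: P Q R => [|x1 y1 h1] [|x2 y2 h2]; try by move=> // <-.
move=> R /= x1O x2O; apply/negP => x3O; have y3O := int_ordinate h3 x3O.
have uO : x1 - x3 \notin O.
  by apply: contra x1O => h; rewrite -(subrK x3 x1) rpredD.
have vO : x2 - x3 \notin O.
  by apply: contra x2O => h; rewrite -(subrK x3 x2) rpredD.
have [[u0 um] [v0 vm]] := (notin_int Oval uO, notin_int Oval vO).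
have := wrel_add R; rewrite (wrel_expand _ _ h3) /= => /eqP; rewrite subr_eq0.
move: (x1 - x3) (x2 - x3) u0 um v0 vm => u v u0 um v0 vm.
have := int_wdx x3O y3O; have := int_wdy x3O y3O.
set p := wdx _ _ _; set q := wdy _ _ _ => qO pO /eqP e.
have := maxid1 O; suff -> : 1 \in maxid O by [].
have -> : 1 = (u ^+ 2 * v ^+ 2) / (u ^+ 2 * v ^+ 2).
  by rewrite divff // mulf_neq0 // expf_neq0.
rewrite {1}e.
set r := (2%:R * p + a1 * q); set s := _ - p ^+ 2.
have -> : (r * (u * v) + q ^+ 2 * (u + v) + s) / (u ^+ 2 * v ^+ 2)
  = r * u^-1 * v^-1 + q ^+ 2 * (u^-1 * v^-1 * (v^-1 + u^-1))
    + s * u^-1 ^+ 2 * v^-1 ^+ 2.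
  by field; rewrite u0 v0.
have rO : r \in O by rewrite /r; in_ring.
have sO : s \in O by rewrite /s; in_ring.
by have ? := maxid_int um; have ? := maxid_int vm; in_maxid Oval.
Qed.

End ValuedCurve.

(** * Translating a point into general position *)

Section GenericTranslate.
Variables (L : closedFieldType) (O : subringClosed L).
Hypothesis Oval : forall x, x \in O \/ x^-1 \in O.
Variable W : weierstrass L.
Local Notation a1 := (wa1 W).
Local Notation a2 := (wa2 W).
Local Notation a3 := (wa3 W).
Local Notation a4 := (wa4 W).
Local Notation a6 := (wa6 W).
Hypotheses (a1O : a1 \in O) (a2O : a2 \in O) (a3O : a3 \in O) (a4O : a4 \in O)
  (a6O : a6 \in O).

Definition avoids (S : seq L) (x : L) :=
  x \in O /\ {in S, forall z, x - z \notin maxid O}.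

Lemma avoids_cat S S' x : avoids (S ++ S') x <-> avoids S x /\ avoids S' x.
Proof.
split=> [[xO h]|[[xO h] [_ h']]].
  by split; split=> // z zS; apply: h; rewrite mem_cat zS ?orbT.
by split=> // z; rewrite mem_cat => /orP[/h|/h'].
Qed.

Lemma avoids_notin S x : avoids S x -> x \notin S.
Proof. by move=> [_ h]; apply/negP => /h; rewrite subrr maxid0. Qed.

Lemma exists_ordinate x : exists y, weqn W x y.
Proof.
have [y e] := @solve_monicpoly L 2
  (nth 0 [:: x ^+ 3 + a2 * x ^+ 2 + a4 * x + a6; - (a1 * x + a3)]) isT.
exists y; apply/eqP; rewrite e !big_ord_recl big_ord0 /= expr0 expr1; ring.
Qed.

(** By [singular_unique] there is at most one residue class to avoid. *)
Lemma avoid_singular : exists S, forall x y (h : weqn W x y),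
  avoids S x -> nonsing O (Aff h).
Proof.
have [[x [y [h s]]]|none] := pselect (exists x y, weqn W x y /\
  singular_red O W x y).
  exists [:: x] => x1 y1 h1 [_ /(_ x (mem_head _ _)) a].
  by apply: contra a => s1; apply: singular_unique h1 h s1 s.
by exists [::] => x y h _; apply/negP => s; apply: none; exists x, y.
Qed.

(** Projective coordinates of the abscissa treat integral points and points of the kernel of
    reduction alike. *)
Lemma primitive_coord x : exists X Z, [/\ Z != 0, X = x * Z, X \in O, Z \in O
  & Z = 1 \/ X = 1 /\ Z \in maxid O].
Proof.
case: (boolP (x \in O)) => xO.
  by exists x, 1; split; rewrite ?oner_eq0 ?mulr1 ?rpred1 //; left.
have [x0 xm] := notin_int Oval xO; exists 1, x^-1.
by split; rewrite ?invr_eq0 ?divff ?rpred1 ?maxid_int //; right.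
Qed.

(** With the abscissa [X / Z] of [P] fixed, any [Q] such that [P + Q] has abscissa [s] has its own
    abscissa among the roots. *)
Definition wrel_poly X Z s := Poly [::
  s ^+ 2 * X ^+ 2 - s * (wb4 W * X * Z + wb6 W * Z ^+ 2) - wb6 W * X * Z
    - wb8 W * Z ^+ 2;
  - (2%:R * s ^+ 2 * X * Z + s * (2%:R * X ^+ 2 + wb2 W * X * Z + wb4 W * Z ^+ 2)
     + wb4 W * X * Z + wb6 W * Z ^+ 2);
  (X - s * Z) ^+ 2].

Lemma horner_wrel_poly X Z s x : (wrel_poly X Z s).[x] = wrel W X Z x s.
Proof. rewrite horner_Poly /= /wrel; ring. Qed.

(** If all coefficients were in the maximal ideal, the leading one would give [X] congruent to
    [s * Z], so [Z = 1] and [x1] congruent to [s]; the other two would then yield [wdy ^+ 2] and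
    [wdx ^+ 2], making the point singular. *)
Lemma wrel_poly_primitive x1 y1 X Z s (h1 : weqn W x1 y1) : nonsing O (Aff h1) ->
  X = x1 * Z -> X \in O -> Z \in O -> (Z = 1 \/ X = 1 /\ Z \in maxid O) ->
  s \in O -> exists i, (wrel_poly X Z s)`_i \notin maxid O.
Proof.
move=> nP eX XO ZO XZ sO; apply: contrapT => /forallNP none.
have {}none i : (wrel_poly X Z s)`_i \in maxid O.
  by apply: contrapT => /negP; apply: none.
have [b2O b4O b6O b8O] := int_wb a1O a2O a3O a4O a6O.
have m2 := none 2%N; have m1 := none 1%N; have m0 := none 0%N.
rewrite !coef_Poly /= in m2 m1 m0.
have {}m2 := maxid_sqr (rpredB XO (rpredM sO ZO)) m2.
case: XZ => [Z1|[X1 Zm]]; last first.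
  have := maxid1 O; suff -> : 1 \in maxid O by [].
  have -> : 1 = (X - s * Z) + s * Z by rewrite X1; ring.
  by in_maxid Oval.
subst Z; rewrite mulr1 in eX; subst X.
have y1O := int_ordinate Oval a1O a2O a3O a4O a6O h1 XO.
rewrite mulr1 in m2; move/negP: nP; apply; apply/and3P.
have dO := int_wdx a1O a2O a4O XO y1O; have dO' := int_wdy a1O a3O XO y1O.
have dy : wdy W x1 y1 \in maxid O.
  apply: maxid_sqr => //.
  have -> : wdy W x1 y1 ^+ 2 = - - (2%:R * s ^+ 2 * x1 * 1
      + s * (2%:R * x1 ^+ 2 + wb2 W * x1 * 1 + wb4 W * 1 ^+ 2)
      + wb4 W * x1 * 1 + wb6 W * 1 ^+ 2)
      + (2%:R * (x1 + s) * x1 + 2%:R * x1 ^+ 2 + wb2 W * x1 + wb4 W) * (x1 - s).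
    by rewrite /wdy /wb2 /wb4 /wb6 (weqn_a6 h1); ring.
  by in_maxid Oval.
split=> //; apply: maxid_sqr => //.
have -> : wdx W x1 y1 ^+ 2 = (s ^+ 2 * x1 ^+ 2
   - s * (wb4 W * x1 * 1 + wb6 W * 1 ^+ 2) - wb6 W * x1 * 1 - wb8 W * 1 ^+ 2)
   + ((x1 + s) * x1 ^+ 2 - wb4 W * x1 - wb6 W) * (x1 - s)
   + wdy W x1 y1 * (- a1 * wdx W x1 y1 + (a2 + 2%:R * x1) * wdy W x1 y1).
  by rewrite /wdy /wdx /wb2 /wb4 /wb6 /wb8 (weqn_a6 h1); ring.
by in_maxid Oval.
Qed.

(** The classes to avoid are the singular one, those of [S] and [x1], and the residue roots of
    [wrel_poly] for each integral forbidden value of [x3]. *)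
Lemma generic_translate P (S : seq L) : nonsing O P ->
  exists x y (h : weqn W x y) x3 y3 (h3 : weqn W x3 y3),
    [/\ nonsing O (Aff h), add_point P (Aff h) = Aff h3, avoids S x
      & avoids S x3].
Proof.
have [S0 nS0] := avoid_singular.
case: P => [|x1 y1 h1] nP.
  have [x xO a] := exists_avoiding Oval (S0 ++ S).
  have [y h] := exists_ordinate x.
  have /avoids_cat[/(nS0 _ _ h) ? ?] : avoids (S0 ++ S) x by [].
  by exists x, y, h, x, y, h.
have [X [Z [Z0 eX XO ZO XZ]]] := primitive_coord x1.
have [b2O b4O b6O b8O] := int_wb a1O a2O a3O a4O a6O.
have [S1 hS1] : exists S1, forall x, avoids S1 x ->
    {in S, forall s, s \in O -> wrel W X Z x s \notin maxid O}.
  elim: (S) => [|s S' [S1 hS1]]; first by exists [::].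
  case: (boolP (s \in O)) => sO; last first.
    exists S1 => x /hS1 a t; rewrite inE => /orP[/eqP ->|]; last exact: a.
    by rewrite (negPf sO).
  have [||S2 hS2] := @primitive_avoiding _ _ Oval (wrel_poly X Z s).
  - by move=> [|[|[|i]]]; rewrite coef_Poly /= ?nth_nil; in_ring.
  - exact: wrel_poly_primitive nP eX XO ZO XZ sO.
  exists (S1 ++ S2) => x /avoids_cat[/hS1 a [xO /(hS2 x xO) b]] t.
  rewrite inE => /orP[/eqP -> _|]; last exact: a.
  by rewrite -horner_wrel_poly.
have [x xO a] := exists_avoiding Oval (S0 ++ S1 ++ x1 :: S).
have /avoids_cat[aS0 /avoids_cat[aS1 aS]] :
  avoids (S0 ++ S1 ++ x1 :: S) x by [].
have [y h] := exists_ordinate x.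
case: aS => _ aS; have ax1 := aS x1 (mem_head _ _).
have ne : x1 != x by apply: contraNneq ax1 => ->; rewrite subrr maxid0.
have [x3 [y3 [h3 e3]]] : exists x3 y3 (h3 : weqn W x3 y3),
    add_point (Aff h1) (Aff h) = Aff h3.
  rewrite /=; destruct (boolP _) as [c|c].
    by case/andP: (c); rewrite (negPf ne).
  by eexists _, _, _.
have r0 : wrel W X Z x x3 = 0.
  by rewrite eX wrel_homog (wrel_add e3) mulr0.
have um : X - x * Z \notin maxid O.
  rewrite eX; case: XZ => [->|[X1 Zm]].
    by rewrite !mulr1; apply: contra ax1 => /maxid_opp; rewrite opprB.
  rewrite -eX X1; apply/negP => m; have := maxid1 O.
  have -> : 1 = (1 - x * Z) + x * Z by ring.
  by apply/negP/negPn; in_maxid Oval.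
(* As a quadratic in [x3] the relation has leading coefficient [(X - x * Z) ^+ 2], a unit by
   [um]. *)
have x3O : x3 \in O.
  apply: (int_of_quadratic Oval (a := (X - x * Z) ^+ 2)
    (b := 2%:R * X * x * (X + x * Z) + wb2 W * X * Z * x
          + wb4 W * (X * Z + x * Z ^+ 2) + wb6 W * Z ^+ 2)
    (c := - (X ^+ 2 * x ^+ 2 - wb4 W * X * Z * x
     - wb6 W * (X * Z + x * Z ^+ 2) - wb8 W * Z ^+ 2))); try by in_ring.
  - by apply: contra um => /maxid_sqr; apply; in_ring.
  - by apply/eqP; rewrite -subr_eq0; apply/eqP; rewrite -[RHS]r0 /wrel; ring.
exists x, y, h, x3, y3, h3; split=> //; first exact: (nS0 _ _ h aS0).
  by split=> // z zS; apply: aS; rewrite inE zS orbT.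
split=> // z zS; case: (boolP (z \in O)) => zO; last first.
  apply: contra zO => /maxid_int zO.
  have -> : z = x3 - (x3 - z) by ring.
  exact: rpredB.
(* [wrel X Z x z - wrel X Z x x3] is divisible by [x3 - z], and its second term is 0. *)
apply: contra (hS1 x aS1 z zS zO) => m.
have -> : wrel W X Z x z = wrel W X Z x z - wrel W X Z x x3.
  by rewrite r0 subr0.
have -> : wrel W X Z x z - wrel W X Z x x3 = - (x3 - z) *
   ((x3 + z) * (X - x * Z) ^+ 2 - (2%:R * X * x * (X + x * Z) + wb2 W * X * Z * x
          + wb4 W * (X * Z + x * Z ^+ 2) + wb6 W * Z ^+ 2)).
  by rewrite /wrel; ring.
by in_maxid Oval.
Qed.

End GenericTranslate.

(** * The abscissa of an endomorphism as a rational function *)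

Section AbscissaMap.
Variables (L : closedFieldType) (W : weierstrass L).

(** The formula [A / B] for the abscissa, with its denominator cleared; the roots of [D] are the
    abscissae on which nothing is claimed. *)
Definition abscissa_map (phi : point W -> point W) (D A B : {poly L}) :=
  forall x y (h : weqn W x y), D.[x] != 0 ->
    exists x' y' (h' : weqn W x' y'),
      phi (Aff h) = Aff h' /\ x' * B.[x] = A.[x].

Lemma abscissa_map_normalize phi (D A B : {poly L}) : D != 0 -> (size B < size A)%N ->
  abscissa_map phi D A B ->
  exists D' A' B' : {poly L}, [/\ D' != 0, A' \is monic, (size B' < size A')%N,
    coprimep A' B' & abscissa_map phi D' A' B'].
Proof.
move=> D0 sBA hm; have A0 : A != 0.
  by rewrite -size_poly_gt0; apply: leq_ltn_trans sBA.
pose g := gcdp A B; have g0 : g != 0 by rewrite gcdp_eq0 (negPf A0).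
have eA : A = A %/ g * g by rewrite divpK // dvdp_gcdl.
have eB : B = B %/ g * g by rewrite divpK // dvdp_gcdr.
have A1 : A %/ g != 0 by apply: contraNneq A0 => e; rewrite eA e mul0r.
have c0 : (lead_coef (A %/ g))^-1 != 0 by rewrite invr_eq0 lead_coef_eq0.
set c := (lead_coef _)^-1 in c0.
(* Cancelling [g] at [x] requires [g.[x] != 0], hence the factor added to [D]. *)
exists (D * g), (c *: (A %/ g)), (c *: (B %/ g)); split.
- by rewrite mulf_neq0.
- by rewrite monicE lead_coefZ mulVf // lead_coef_eq0.
- rewrite !size_scale // !size_divp //; move: sBA.
  have := leq_gcdpl B A0; rewrite -/g.
  have : (0 < size g)%N by rewrite size_poly_gt0.
  by case: (size g) => // m _ /= sg sBA; apply: ltn_sub2r => //; apply: leq_trans sBA _.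
- by rewrite coprimepZl // coprimepZr // coprimep_div_gcd // A0.
move=> x y h; rewrite hornerM mulf_eq0 negb_or => /andP[/(hm x y h)].
move=> [x' [y' [h' [e e']]]] gx; exists x', y', h'; split=> //.
apply: (mulIf gx); rewrite !hornerZ; move: e'; rewrite {1}eB {1}eA !hornerM => e'.
transitivity (c * (x' * ((B %/ g).[x] * g.[x]))); first by ring.
by rewrite e'; ring.
Qed.

End AbscissaMap.

(** * From integral fibres to preservation of non-singular reduction *)

Section Descent.
Variables (L : closedFieldType) (O : subringClosed L).
Hypothesis Oval : forall x, x \in O \/ x^-1 \in O.
Variable W : weierstrass L.
Hypotheses (a1O : wa1 W \in O) (a2O : wa2 W \in O) (a3O : wa3 W \in O)
  (a4O : wa4 W \in O) (a6O : wa6 W \in O).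
Hypothesis ell : wdisc W != 0.

Lemma endo_opp (phi : point W -> point W) P : phi Inf = Inf ->
  {morph phi : P Q / add_point P Q} -> phi (opp_point P) = opp_point (phi P).
Proof.
by move=> p0 pD; apply: opp_inf_eq; rewrite -pD add_opp_point.
Qed.

(** These are [g] and [h]: [psi_phi] is what remains of [h g = n], and [phi_psi] of [g = t - h]. *)
Variables phi psi : point W -> point W.
Hypotheses (phi0 : phi Inf = Inf) (phiD : {morph phi : P Q / add_point P Q}).
Hypotheses (psi0 : psi Inf = Inf) (psiD : {morph psi : P Q / add_point P Q}).
Hypothesis psi_phi : forall P, in_kernel O P -> in_kernel O (psi (phi P)).
Hypothesis phi_psi : forall P, nonsing O P -> in_kernel O (psi P) ->
  nonsing O (phi P).

(** Since [P = (P + Q) - Q] and the kernel is a subgroup, [psi] cannot send both [P + Q] and [Q]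
    into it; one of them, for a generic [Q], is the point sought. *)
Lemma generic_outside P (S : seq L) : nonsing O P -> ~~ in_kernel O (psi P) ->
  exists x y (h : weqn W x y),
    [/\ nonsing O (Aff h), ~~ in_kernel O (psi (Aff h)) & x \notin S].
Proof.
move=> nP kP.
have [x [y [h [x3 [y3 [h3 [n e /avoids_notin a /avoids_notin a3]]]]]]] :=
  generic_translate Oval a1O a2O a3O a4O a6O S nP.
case: (boolP (in_kernel O (psi (Aff h)))) => k; last by exists x, y, h.
exists x3, y3, h3; split=> //.
  rewrite -e; apply: (nonsing_add Oval) => //.
apply: contra kP => k3; rewrite -(add_pointK P (Aff h) ell) e psiD.
rewrite (endo_opp _ psi0 psiD); apply: (kernel_add Oval) => //.
exact: kernel_opp.
Qed.

Section Generic.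
Variables D A B : {poly L}.
Hypotheses (D0 : D != 0) (Amon : A \is monic) (sBA : (size B < size A)%N)
  (cop : coprimep A B) (map_phi : abscissa_map phi D A B).

Lemma monic_sub_scale r : A - r *: B \is monic.
Proof.
by rewrite monicE lead_coefDl ?size_polyN ?(leq_ltn_trans (size_scale_leq _ _)).
Qed.

(* If phi P = +-R then psi (phi P) is not in the kernel of reduction, so
   neither is P: the abscissae in the fibre of phi above R are integral. *)
Lemma fibre_int xr yr (hr : weqn W xr yr) z : ~~ in_kernel O (psi (Aff hr)) ->
  D.[z] != 0 -> root (A - xr *: B) z -> z \in O.
Proof.
move=> kr Dz rz; apply: contraT => zO.
have [y h] := exists_ordinate W z.
have [x' [y' [h' [e e']]]] := map_phi h Dz.
have Az : A.[z] = xr * B.[z].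
  by move: rz; rewrite /root !hornerE subr_eq0 => /eqP.
have Bz : B.[z] != 0.
  apply/eqP => Bz; have := coprimep_root cop (x := z).
  by rewrite /root Az Bz mulr0 eqxx => /(_ isT).
have ex : x' = xr by apply: (mulIf Bz); rewrite e'.
subst x'; suff : ~~ in_kernel O (psi (Aff h')) by rewrite -e psi_phi.
case: (same_abscissa hr h') => [->//|->]; rewrite (endo_opp _ psi0 psiD).
by apply: contra kr => /kernel_opp; rewrite opp_pointK.
Qed.

Lemma generic_nonsing : exists S, forall x y (h : weqn W x y),
  avoids O S x -> nonsing O (phi (Aff h)).
Proof.
have [S0 nS0] := avoid_singular Oval a1O a2O a3O a4O a6O.
have [[x0 [y0 [h0 s0]]]|none] := pselect (exists x y, weqn W x y /\
  singular_red O W x y); last first.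
  exists [::] => x y h _; case: (phi _) => // x' y' h'; apply/negP => s.
  by apply: none; exists x', y'.
have [[R [nR kR]]|none] := pselect (exists R, nonsing O R /\
  ~~ in_kernel O (psi R)); last first.
  exists S0 => x y h /(nS0 _ _ h) n; apply: phi_psi => //.
  by apply: contrapT => /negP k; apply: none; exists (Aff h).
have [Ds defD] := closed_field_poly_normal D.
have rootD x : x \notin Ds -> D.[x] != 0.
  apply: contra => /eqP Dx; rewrite -root_prod_XsubC.
  move: Dx; rewrite {1}defD hornerZ => /eqP.
  by rewrite mulf_eq0 lead_coef_eq0 (negPf D0).
(* A common root [z] of [D] and [A - xr *: B] would give [xr = A.[z] / B.[z]]; excluding these
   values makes [map_phi] applicable to the whole fibre. *)
have [xr [yr [hr [nr kr xrS]]]] :=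
  generic_outside [seq A.[z] / B.[z] | z <- Ds] nR kR.
have [rs defr] := closed_field_poly_normal (A - xr *: B).
rewrite (monicP (monic_sub_scale xr)) scale1r in defr.
have rsO : {subset rs <= O}.
  move=> z; rewrite -root_prod_XsubC -defr => rz.
  apply: (fibre_int kr) (rz); apply: rootD; apply: contra xrS => zD.
  apply/mapP; exists z => //; move: rz; rewrite /root !hornerE subr_eq0 => /eqP Az.
  rewrite Az mulfK //; apply/eqP => Bz.
  have := coprimep_root cop (x := z).
  by rewrite /root Az Bz mulr0 eqxx => /(_ isT).
have [ss defs] := closed_field_poly_normal (A - x0 *: B).
rewrite (monicP (monic_sub_scale x0)) scale1r in defs.
exists (Ds ++ ss) => x y h /avoids_cat[aD [xO /(unit_prod_XsubC Oval) as_]].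
have [x' [y' [h' [-> e]]]] := map_phi h (rootD _ (avoids_notin aD)).
apply/negP => /= s'.
have m : x' - x0 \in maxid O.
  exact: (singular_unique Oval a1O a2O a3O a4O a6O h' h0 s' s0).
(* Otherwise [R] would be congruent in abscissa to a singular point. *)
have u : x' - xr \notin maxid O.
  apply: contra nr => /maxid_opp; rewrite opprB.
  exact: (singular_near Oval a1O a2O a3O a4O a6O hr h' s').
have [u0 uV] := unit_int Oval u.
(* Since [x' * B.[x] = A.[x]], the value of [A - r *: B] at [x] is [(x' - r) * B.[x]], used for
   [r = xr] here and for [r = x0] at the end. *)
have := int_prod_XsubC rsO xO; rewrite -defr !hornerE -e -mulrBl => BO.
have {}BO : B.[x] \in O.
  have -> : B.[x] = (x' - xr)^-1 * ((x' - xr) * B.[x]) by rewrite mulKf.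
  exact: rpredM.
move: as_; rewrite -defs !hornerE -e -mulrBl; apply/negP/negPn.
exact: maxid_mulr.
Qed.

End Generic.

Lemma nonsing_of_generic :
  (exists S, forall x y (h : weqn W x y), avoids O S x -> nonsing O (phi (Aff h))) ->
  forall P, nonsing O P -> nonsing O (phi P).
Proof.
move=> [S hS] P nP.
have [x [y [h [x3 [y3 [h3 [n e a a3]]]]]]] :=
  generic_translate Oval a1O a2O a3O a4O a6O S nP.
rewrite -(add_pointK P (Aff h) ell) phiD (endo_opp _ phi0 phiD) e.
apply: (nonsing_add Oval) => //; first exact: hS.
by apply: (nonsing_opp Oval) => //; apply: hS.
Qed.

End Descent.

(** * Evaluation of multivariate polynomials *)

Lemma mpoly_ring_ind (n : nat) (R : comNzRingType) (P : {mpoly R[n]} -> Prop) :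
  (forall c, P c%:MP) -> (forall i, P 'X_i) ->
  (forall f g, P f -> P g -> P (f + g)) ->
  (forall f g, P f -> P g -> P (f * g)) -> forall f, P f.
Proof.
move=> PC PX PD PM; elim/mpolyind => [|c m f _ _ Pf].
  by rewrite -mpolyC0; apply: PC.
apply: (PD) => //; rewrite -mul_mpolyC; apply: (PM) => //; rewrite mpolyXE_id.
elim/big_rec: _ => [|i g _ Pg]; first by rewrite -mpolyC1; apply: (PC).
apply: (PM) => //; elim: (m i) => [|k IH]; first by rewrite expr0 -mpolyC1.
by rewrite exprS; apply: (PM).
Qed.

Lemma meval_homog (n d : nat) (R : comNzRingType) (f : {mpoly R[n]})
    (c : R) (u v : 'I_n -> R) :
  f \is d.-homog -> (forall i, u i = c * v i) -> f.@[u] = c ^+ d * f.@[v].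
Proof.
move=> /dhomogP hf uv; rewrite !mevalE big_distrr /= big_seq [RHS]big_seq.
apply: eq_bigr => m /hf dm; have {}dm : mdeg m = d := dm.
rewrite mdegE in dm.
rewrite mulrCA; congr (_ * _); rewrite -dm expr_sum -big_split /=.
by apply: eq_bigr => i _; rewrite uv exprMn.
Qed.

Lemma map_mpoly_homog (n d : nat) (R S : fieldType) (j : {rmorphism R -> S})
    (f : {mpoly R[n]}) : f \is d.-homog -> map_mpoly j f \is d.-homog.
Proof.
by rewrite !dhomogE (perm_all _ (msupp_map_mpoly _ (fmorph_inj j))).
Qed.

Lemma meval_map_mpoly (n : nat) (R S : comNzRingType) (j : {rmorphism R -> S})
    (f : {mpoly R[n]}) (v : 'I_n -> R) (u : 'I_n -> S) :
  (forall i, u i = j (v i)) -> (map_mpoly j f).@[u] = j f.@[v].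
Proof.
move=> uv; elim/mpoly_ring_ind: f => [c|i|f g Ef Eg|f g Ef Eg].
- by rewrite map_mpolyC !mevalC.
- by rewrite map_mpolyX !mevalXU uv.
- by rewrite rmorphD !mevalD Ef Eg rmorphD.
- by rewrite rmorphM !mevalM Ef Eg rmorphM.
Qed.

(** * Estimates near the point at infinity *)

Section NearInfinity.
Variables (L : fieldType) (O : subringClosed L).
Hypothesis Oval : forall x, x \in O \/ x^-1 \in O.

(** Neighbourhoods of 0 in the valuation topology; a finite list of multipliers takes the place of a
    bound in the value group. *)
Definition small (S : seq L) (x : L) := {in S, forall c, c * x \in maxid O}.

Lemma small_cat S T x : small (S ++ T) x <-> small S x /\ small T x.
Proof.
split=> [h|[hS hT] c]; last by rewrite mem_cat => /orP[/hS|/hT].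
by split=> c cS; apply: h; rewrite mem_cat cS ?orbT.
Qed.

Lemma small_cons c S x : small (c :: S) x <-> c * x \in maxid O /\ small S x.
Proof.
split=> [h|[hc hS] d]; last by rewrite inE => /orP[/eqP ->|/hS].
by split=> [|d dS]; apply: h; rewrite inE ?eqxx ?dS ?orbT.
Qed.

Lemma exists_small S : (exists2 t, t != 0 & t \in maxid O) ->
  exists2 x, x != 0 & small S x.
Proof.
move=> [t t0 tm]; elim: S => [|c S [x x0 xS]].
  by exists 1; rewrite ?oner_eq0.
case: (boolP (c * x \in maxid O)) => m; first by exists x => //; apply/small_cons.
have [cx0 cxV] := unit_int Oval m.
(* The new factor is in [O], so earlier conditions persist, and it turns [c * x] into [t]. *)
exists (x * (t * (c * x)^-1)); first by rewrite !mulf_neq0 // invr_eq0.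
apply/small_cons; split=> [|d /xS h].
  by rewrite mulrA mulrCA divff // mulr1.
rewrite mulrA; apply: maxid_mulr => //; apply: rpredM => //; exact: maxid_int.
Qed.

Lemma poly_at_infinity (p : {poly L}) : p != 0 -> exists S, forall x, x != 0 ->
  small S x^-1 -> p.[x] / (lead_coef p * x ^+ (size p).-1) - 1 \in maxid O.
Proof.
elim/poly_ind: p => [|p a IH]; first by rewrite eqxx.
have [->|p0] := eqVneq p 0.
  rewrite mul0r add0r polyC_eq0 => a0; exists [::] => x x0 _.
  by rewrite lead_coefC hornerC size_polyC a0 /= expr0 mulr1 divff ?subrr ?maxid0.
have [S hS] := IH p0; move=> _.
have sp : (0 < size p)%N by rewrite size_poly_gt0.
have lp : lead_coef (p * 'X + a%:P) = lead_coef p.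
  rewrite lead_coefDl ?lead_coefMX // size_mulX //.
  by apply: leq_ltn_trans (size_polyC_leq1 _) _.
have l0 : lead_coef p != 0 by rewrite lead_coef_eq0.
exists (1 :: a / lead_coef p :: S) => x x0.
move=> /small_cons[xm /small_cons[am /(hS x x0) h]]; rewrite mul1r in xm.
rewrite lp size_MXaddC (negPf p0) /= !hornerE.
have -> : (p.[x] * x + a) / (lead_coef p * x ^+ size p) - 1
  = (p.[x] / (lead_coef p * x ^+ (size p).-1) - 1)
    + a / lead_coef p / x * x^-1 ^+ (size p).-1.
  rewrite -{1}(prednK sp) exprS exprVn; field.
  by rewrite l0 x0 expf_neq0.
apply: maxid_add => //; apply: maxid_mulr => //; apply: rpredX; exact: maxid_int.
Qed.

Lemma poly_at_infinity_unit (p : {poly L}) : p != 0 -> exists S, forall x,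
  x != 0 -> small S x^-1 ->
  let e := p.[x] / (lead_coef p * x ^+ (size p).-1) in
  [/\ p.[x] != 0, e != 0, e \notin maxid O & e^-1 \notin maxid O].
Proof.
move=> /poly_at_infinity[S hS]; exists S => x x0 /(hS x x0) h e.
have em : e \notin maxid O.
  apply: contra (maxid1 O) => em; have -> : 1 = e - (e - 1) by ring.
  exact: maxid_sub.
have [e0 _] := unit_int Oval em.
split=> //; first by apply: contraNneq e0; rewrite /e => ->; rewrite mul0r.
have eO : e \in O.
  have -> : e = (e - 1) + 1 by ring.
  by rewrite rpredD ?rpred1 ?maxid_int.
apply: contra (maxid1 O) => m.
by rewrite -(divff e0) maxid_mull.
Qed.

Variable W : weierstrass L.
Local Notation a1 := (wa1 W).
Local Notation a2 := (wa2 W).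
Local Notation a3 := (wa3 W).
Local Notation a4 := (wa4 W).
Local Notation a6 := (wa6 W).
Hypotheses (a1O : a1 \in O) (a2O : a2 \in O) (a3O : a3 \in O) (a4O : a4 \in O)
  (a6O : a6 \in O).

(** Near infinity [y ^+ 2] behaves like [x ^+ 3], so [y / x] is large. If [c * (x / y)] were not in
    the maximal ideal, then [y = c * x * e] with [e] integral, and the equation divided by [x ^+ 3]
    would give 1 in it. *)
Lemma ordinate_dominates c x y : weqn W x y -> x != 0 -> x^-1 \in maxid O ->
  c / x \in maxid O -> c ^+ 2 / x \in maxid O ->
  [/\ y != 0, c * (x / y) \in maxid O & c * y^-1 \in maxid O].
Proof.
move=> h x0 xm cm1 cm2; have xO := maxid_int xm.
have key d e : d / x \in maxid O -> d ^+ 2 / x \in maxid O -> e \in O ->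
    y != d * x * e.
  move=> dm dm2 eO; have dO := maxid_int dm; apply: contraNneq (maxid1 O) => ey.
  have -> : 1 = d ^+ 2 / x * e ^+ 2 + a1 * (d / x) * e + a3 * (d / x) * x^-1 * e
      - a2 * x^-1 - a4 * x^-1 ^+ 2 - a6 * x^-1 ^+ 3.
    by rewrite (weqn_a6 h) ey; field.
  by in_maxid Oval.
have y0 : y != 0.
  have := key 0 0; rewrite !(mulr0, expr0n) /= !mul0r.
  by apply; rewrite ?maxid0 ?rpred0.
have m : c * (x / y) \in maxid O.
  apply: contraT => m; have [_ mV] := unit_int Oval m.
  have c0 : c != 0 by apply: contraNneq m => ->; rewrite mul0r maxid0.
  have /eqP[] := key c _ cm1 cm2 mV.
  by field; rewrite c0 x0 y0.
split=> //; have -> : c * y^-1 = c * (x / y) * x^-1.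
  by field; rewrite x0 y0.
exact: maxid_mulr.
Qed.

Lemma ordinate_large T : exists S, forall x y, weqn W x y -> x != 0 ->
  small S x^-1 -> [/\ y != 0, small T (x / y) & small T y^-1].
Proof.
exists (1 :: T ++ [seq c ^+ 2 | c <- T]) => x y h x0.
move=> /small_cons[]; rewrite mul1r => xm /small_cat[T1 T2].
have key c cT := ordinate_dominates h x0 xm (T1 c cT) (T2 _ (map_f _ cT)).
split=> [|c /key[]//|c /key[]//].
by have [] := @ordinate_dominates 0 x y; rewrite ?expr0n ?mul0r ?maxid0.
Qed.

(** The opposite passage: for [x = c * e] with [e] integral, the equation divided by [y ^+ 2] would
    put 1 into the maximal ideal. The term [x ^+ 3] is the reason for the cubes in the list. *)
Lemma abscissa_large T : exists S, forall x y, weqn W x y -> y != 0 ->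
  small S y^-1 -> x != 0 /\ small T x^-1.
Proof.
exists (1 :: T ++ [seq c ^+ 2 | c <- T] ++ [seq c ^+ 3 | c <- T]) => x y h y0.
move=> /small_cons[]; rewrite mul1r => ym /small_cat[T1 /small_cat[T2 T3]].
have yO := maxid_int ym.
have key c e : c / y \in maxid O -> c ^+ 2 / y \in maxid O ->
    c ^+ 3 / y \in maxid O -> e \in O -> x != c * e.
  move=> m1 m2 m3 eO; have cO := maxid_int m1; apply: contraNneq (maxid1 O) => ex.
  have -> : 1 = (c ^+ 3 / y * e ^+ 3 + a2 * (c ^+ 2 / y) * e ^+ 2
       + a4 * (c / y) * e + a6 * y^-1) * y^-1 - a1 * (c / y) * e - a3 * y^-1.
    by rewrite (weqn_a6 h) ex; field.
  by in_maxid Oval.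
have x0 : x != 0.
  have := key 0 0; rewrite !(mulr0, expr0n) /= !mul0r.
  by apply; rewrite ?maxid0 ?rpred0.
split=> // c cT; apply: contraT => m; have [_ mV] := unit_int Oval m.
have c0 : c != 0 by apply: contraNneq m => ->; rewrite mul0r maxid0.
have /eqP[] := key c _ (T1 c cT) (T2 _ (map_f _ cT)) (T3 _ (map_f _ cT)) mV.
by field; rewrite c0 x0.
Qed.

(** The chart around [(0 : 1 : 0)] with coordinates [s = x / y] and [t = 1 / y]. *)
Definition near_inf (s t : L) : 'I_3 -> L := tnth [tuple s; 1; t].

Lemma mpoly_near_inf (f : {mpoly L[3]}) T : exists S, forall s t,
  small S s -> small S t -> small T (f.@[near_inf s t] - f.@[near_inf 0 0]).
Proof.
elim/mpoly_ring_ind: f T => [c|i|f g Hf Hg|f g Hf Hg] T.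
- by exists [::] => s t _ _ d _; rewrite !mevalC subrr mulr0 maxid0.
- exists T => s t hs ht d dT; rewrite !mevalXU /near_inf !(tnth_nth 0).
  case: i => -[|[|[|//]]] /= _; rewrite ?subr0 ?subrr; first exact: hs.
    by rewrite mulr0 maxid0.
  exact: ht.
- have [S1 h1] := Hf T; have [S2 h2] := Hg T.
  exists (S1 ++ S2) => s t /small_cat[s1 s2] /small_cat[t1 t2] d dT.
  rewrite !mevalD; set p := f.@[_]; set q := g.@[_].
  have -> : d * (p + q - (f.@[near_inf 0 0] + g.@[near_inf 0 0]))
    = d * (p - f.@[near_inf 0 0]) + d * (q - g.@[near_inf 0 0]) by ring.
  by apply: maxid_add => //; [apply: h1|apply: h2].
set f0 := f.@[near_inf 0 0]; set g0 := g.@[near_inf 0 0].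
(* The multipliers [d * g0] and [d * f0] serve the cross terms of [p * q - f0 * g0]; the 1 in the
   second list makes [q - g0] integral. *)
have [S1 h1] := Hf (T ++ [seq d * g0 | d <- T]).
have [S2 h2] := Hg (1 :: [seq d * f0 | d <- T]).
exists (S1 ++ S2) => s t /small_cat[s1 s2] /small_cat[t1 t2] d dT.
have /small_cat[/(_ d dT) m1 /(_ _ (map_f _ dT)) m2] := h1 s t s1 t1.
have /small_cons[m3 /(_ _ (map_f _ dT)) m4] := h2 s t s2 t2.
move: m1 m2 m3 m4; rewrite !mevalM -/f0 -/g0.
move: f.@[_] g.@[_] => p q m1 m2; rewrite mul1r => m3 m4.
have -> : d * (p * q - f0 * g0) =
  d * (p - f0) * (q - g0) + d * g0 * (p - f0) + d * f0 * (q - g0) by ring.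
have := maxid_int m3 => ?.
by apply: maxid_add => //; apply: maxid_add => //; apply: maxid_mulr.
Qed.

Lemma hcoord_near_inf x y (h : weqn W x y) i : y != 0 ->
  hcoord (Aff h) i = y * near_inf (x / y) y^-1 i.
Proof.
move=> y0; rewrite /hcoord /near_inf !(tnth_nth 0).
by case: i => -[|[|[|//]]] /= _; field.
Qed.

End NearInfinity.

(** * Existence of the rational function and of its pole at infinity *)

Section EndomorphismAbscissa.
Variables (L : closedFieldType) (W : weierstrass L).
Local Notation a1 := (wa1 W).
Local Notation a2 := (wa2 W).
Local Notation a3 := (wa3 W).
Local Notation a4 := (wa4 W).
Local Notation a6 := (wa6 W).

Definition cubic_poly : {poly L} := 'X^3 + a2 *: 'X^2 + a4 *: 'X + a6%:P.
Definition linear_poly : {poly L} := a1 *: 'X + a3%:P.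

(** Higher powers of [y] are removed by [y ^+ 2 = cubic_poly - linear_poly * y]. *)
Lemma mpoly_on_curve (f : {mpoly L[3]}) : exists a b : {poly L},
  forall x y (h : weqn W x y), f.@[hcoord (Aff h)] = a.[x] + b.[x] * y.
Proof.
elim/mpoly_ring_ind: f => [c|i|f g [a [b Hf]] [a' [b' Hg]]|
  f g [a [b Hf]] [a' [b' Hg]]].
- by exists c%:P, 0 => x y h; rewrite mevalC !hornerE ?mul0r ?addr0.
- have [e|[e|e]] : i = inord 0 \/ i = inord 1 \/ i = inord 2.
    case: i => -[|[|[|//]]] lti; [left|right;left|right;right];
    by apply: val_inj; rewrite /= inordK.
  + by exists 'X, 0 => x y h; rewrite mevalXU e /= (tnth_nth 0) inordK //=
       !hornerE ?mul0r ?addr0.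
  + by exists 0, 1 => x y h; rewrite mevalXU e /= (tnth_nth 0) inordK //=
       !hornerE ?mul1r ?add0r.
  + by exists 1, 0 => x y h; rewrite mevalXU e /= (tnth_nth 0) inordK //=
       !hornerE ?mul0r ?addr0.
- by exists (a + a'), (b + b') => x y h; rewrite mevalD Hf Hg !hornerD; ring.
exists (a * a' + b * b' * cubic_poly), (a * b' + a' * b - b * b' * linear_poly).
move=> x y h; rewrite mevalM Hf Hg /cubic_poly /linear_poly
    !(hornerD, hornerN, hornerM, hornerZ, hornerXn, hornerX, hornerC)
    (weqn_a6 h).
by ring.
Qed.

Variables (k : fieldType) (j : {rmorphism k -> L}).
Variable O : subringClosed L.
Hypothesis Oval : forall x, x \in O \/ x^-1 \in O.
Hypothesis maxid_neq0 : exists2 t, t != 0 & t \in maxid O.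
Hypotheses (a1O : a1 \in O) (a2O : a2 \in O) (a3O : a3 \in O) (a4O : a4 \in O)
  (a6O : a6 \in O).
Hypothesis two_neq0 : 2%:R != 0 :> L.

(** Continuity of [phi] at infinity. As [phi] fixes [Inf], the second polynomial takes a nonzero
    value [c] there and the third vanishes; their quotient [1 / y'] is therefore small nearby, and
    [abscissa_large] passes to [x']. *)
Lemma endomorphism_near_inf (phi : point W -> point W) (d : nat)
    (f : 'I_3 -> {mpoly k[3]}) :
  let ev (Q : point W) i := (map_mpoly j (f i)).@[hcoord Q] in
  (forall i, f i \is d.-homog) -> (exists i, ev Inf i != 0) ->
  (forall Q, (exists i, ev Q i != 0) -> same_point (ev Q) (hcoord (phi Q))) ->
  phi Inf = Inf ->
  forall T, exists S, forall x y (h : weqn W x y), x != 0 -> small O S x^-1 ->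
    ev (Aff h) (inord 1) != 0 /\
    forall x' y' (h' : weqn W x' y'), phi (Aff h) = Aff h' ->
      x' != 0 /\ small O T x'^-1.
Proof.
move=> ev hom ev0 sp phi0 T.
have evInf i : ev Inf i = (map_mpoly j (f i)).@[near_inf 0 0].
  by apply: meval_eq => i'; rewrite /near_inf /= !(tnth_nth 0).
have [c c0 ec] := sp _ ev0; rewrite phi0 in ec.
have f1 : (map_mpoly j (f (inord 1))).@[near_inf 0 0] = c.
  by rewrite -evInf ec /= (tnth_nth 0) inordK //= mulr1.
have f2 : (map_mpoly j (f (inord 2))).@[near_inf 0 0] = 0.
  by rewrite -evInf ec /= (tnth_nth 0) inordK //= mulr0.
have [T1 hT1] := abscissa_large Oval a1O a2O a3O a4O a6O T.
have [S1 hS1] := mpoly_near_inf Oval (map_mpoly j (f (inord 1))) [:: c^-1].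
have [S2 hS2] := mpoly_near_inf Oval (map_mpoly j (f (inord 2))) [seq t / c | t <- T1].
have [S hS] := ordinate_large Oval a1O a2O a3O a4O a6O (S1 ++ S2).
exists S => x y h x0 xS.
have [y0 /small_cat[s1 s2] /small_cat[t1 t2]] := hS _ _ h x0 xS.
have {hS1} := hS1 _ _ s1 t1; have {hS2} := hS2 _ _ s2 t2.
rewrite f1 f2 subr0; set u1 := _.@[_]; set u2 := _.@[_] => h2.
move=> /small_cons[h1 _].
have e1 : ev (Aff h) (inord 1) = y ^+ d * u2.
  apply: meval_homog; first exact: map_mpoly_homog.
  by move=> i; apply: hcoord_near_inf.
have e2 : ev (Aff h) (inord 2) = y ^+ d * u1.
  apply: meval_homog; first exact: map_mpoly_homog.
  by move=> i; apply: hcoord_near_inf.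
have um : c^-1 * u2 \notin maxid O.
  apply: contra (maxid1 O) => m.
  have -> : 1 = c^-1 * u2 - c^-1 * (u2 - c) by field.
  exact: maxid_sub.
have [v0 vO] := unit_int Oval um.
have u20 : u2 != 0 by apply: contraNneq v0 => ->; rewrite mulr0.
have n1 : ev (Aff h) (inord 1) != 0 by rewrite e1 mulf_neq0 // expf_neq0.
split=> // x' y' h' eh; have [|c' c'0 ec'] := sp (Aff h).
  by exists (inord 1).
have := ec' (inord 1); have := ec' (inord 2); rewrite e1 e2 eh /=.
rewrite !(tnth_nth 0) !inordK //= mulr1 => eu2 eu1.
have yd0 : y ^+ d != 0 by rewrite expf_neq0.
have y'0 : y' != 0.
  by apply: contraTneq n1 => y'0; rewrite e1 eu1 y'0 mulr0 eqxx.
have ey' : y'^-1 = u1 / u2.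
  have u10 : u1 != 0 by apply: contraNneq c'0 => u10; rewrite -eu2 u10 mulr0.
  have -> : y' = u2 / u1.
    apply: (mulfI c'0); rewrite -eu1 -eu2; field; exact: u10.
  by rewrite invf_div.
apply: (hT1 _ _ h' y'0) => t tT; rewrite ey'.
have -> : t * (u1 / u2) = t / c * u1 * (c^-1 * u2)^-1.
  by field; rewrite c0 u20.
by apply: maxid_mulr => //; apply: h2; apply/mapP; exists t.
Qed.

(** As [phi] commutes with negation, points above the same [x] have images with the same abscissa
    [x']. Comparing [x' (A2 + B2 y) = A0 + B0 y] at the two ordinates separates it into [x' A2 = A0]
    and [x' B2 = B0]. The first alternative is the case [A2 = B2 = 0]. *)
Lemma endomorphism_abscissa (phi : point W -> point W) :
  endomorphism_over j phi ->
  (exists2 D : {poly L}, D != 0 &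
     forall x y (h : weqn W x y), D.[x] != 0 -> phi (Aff h) = Inf) \/
  exists D A B : {poly L},
    [/\ D != 0, (size B < size A)%N & abscissa_map phi D A B].
Proof.
move=> [mor phi0 phiD]; have [d [f [hom ev0 sp]]] := mor Inf.
have near := endomorphism_near_inf hom ev0 sp phi0.
pose ev (Q : point W) i := (map_mpoly j (f i)).@[hcoord Q].
have [A0 [B0 e0]] := mpoly_on_curve (map_mpoly j (f (inord 0))).
have [A1 [B1 e1]] := mpoly_on_curve (map_mpoly j (f (inord 1))).
have [A2 [B2 e2]] := mpoly_on_curve (map_mpoly j (f (inord 2))).
have large D : D != 0 -> forall S, exists x, [/\ x != 0, small O S x^-1 & D.[x] != 0].
  move=> D0 S; have [S' hS'] := poly_at_infinity_unit Oval D0.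
  have [t t0 /small_cat[tS tS']] := exists_small Oval (S ++ S') maxid_neq0.
  exists t^-1; rewrite invr_eq0 invrK; split=> //.
  by have [] := hS' t^-1; rewrite ?invr_eq0 ?invrK.
(* The norm of [A1 + B1 y] down to polynomials in [x]: it is nonzero where the second coordinate is
   nonzero at both points above [x], as happens near infinity. *)
pose N1 := A1 ^+ 2 - A1 * B1 * linear_poly - B1 ^+ 2 * cubic_poly.
have eN1 x y (h : weqn W x y) :
    N1.[x] = ev (Aff h) (inord 1) * ev (Aff (weqn_neg h)) (inord 1).
  rewrite /ev !e1 /N1 /linear_poly /cubic_poly
    !(hornerD, hornerN, hornerM, hornerZ, hornerXn, hornerX, hornerC)
    (weqn_a6 h) /neg_y; ring.
have N10 : N1 != 0.
  have [S hS] := near [::].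
  have [x [x0 xS _]] := large 1 (oner_neq0 _) S.
  have [y h] := exists_ordinate W x.
  apply: contraTneq (mulf_neq0 (hS _ _ h x0 xS).1 (hS _ _ (weqn_neg h) x0 xS).1).
  by move=> N10; rewrite -[_ * _]eN1 N10 horner0 eqxx.
(* The 2-division polynomial; off its roots the two ordinates above [x] differ. *)
pose P4 : {poly L} := 4%:R *: 'X^3 + wb2 W *: 'X^2 + (2%:R * wb4 W) *: 'X + (wb6 W)%:P.
have P40 : P4 != 0.
  apply/eqP => /(congr1 (fun p : {poly L} => p`_3)).
  rewrite /P4 !coefD !coefZ !coefXn coefX coefC coef0 /= mulr1 !mulr0 !addr0.
  apply/eqP; have -> : 4%:R = 2%:R * 2%:R :> L by ring.
  by rewrite mulf_neq0.
have eP4 x y : weqn W x y -> P4.[x] = (neg_y W x y - y) ^+ 2.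
  by move=> h; rewrite /P4
    !(hornerD, hornerN, hornerM, hornerZ, hornerXn, hornerX, hornerC)
    /wb2 /wb4 /wb6 /neg_y (weqn_a6 h); ring.
pose D := N1 * P4; have D0 : D != 0 by rewrite mulf_neq0.
have good x y (h : weqn W x y) : D.[x] != 0 ->
    [/\ same_point (ev (Aff h)) (hcoord (phi (Aff h))),
      same_point (ev (Aff (weqn_neg h))) (hcoord (opp_point (phi (Aff h))))
      & neg_y W x y - y != 0].
  rewrite hornerM mulf_eq0 negb_or (eP4 _ _ h) (eN1 _ _ h) mulf_eq0 negb_or.
  move=> /andP[/andP[n1 n2]].
  rewrite expf_eq0 /= => n; rewrite -(endo_opp _ phi0 phiD).
  by split=> //; apply: sp; exists (inord 1).
have [[a20 b20]|nz] := pselect (A2 = 0 /\ B2 = 0).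
  left; exists D => // x y h Dx; have [[c c0 ec] _ _] := good x y h Dx.
  have := ec (inord 2); rewrite [LHS]e2 a20 b20 !horner0 mul0r addr0.
  case: (phi _) => //= x' y' h'; rewrite (tnth_nth 0) inordK //= mulr1 => e.
  by rewrite -e eqxx in c0.
right.
have key x y (h : weqn W x y) : D.[x] != 0 -> (A2.[x] != 0) || (B2.[x] != 0) ->
    exists x' y' (h' : weqn W x' y'), phi (Aff h) = Aff h' /\
      (x' * A2.[x] = A0.[x] /\ x' * B2.[x] = B0.[x]).
  move=> Dx AB; have [[c c0 ec] [c' c'0 ec'] n] := good x y h Dx.
  have lin a b : a + b * y = 0 -> a + b * neg_y W x y = 0 -> a = 0 /\ b = 0.
    move=> q1 q2; have b0 : b = 0.
      apply: (mulIf n); rewrite mul0r -[RHS](subrr (a + b * y)) {1}q1 -q2; ring.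
    by split=> //; move: q1; rewrite b0 mul0r addr0.
  move: (ec (inord 0)) (ec (inord 2)) (ec' (inord 0)) (ec' (inord 2)).
  rewrite /ev !e0 !e2; case: (phi (Aff h)) => [|x' y' h'] /=.
    rewrite !(tnth_nth 0) !inordK //= !mulr0 => _ q1 _ q2.
    by have [z1 z2] := lin _ _ q1 q2; rewrite z1 z2 eqxx in AB.
  rewrite !(tnth_nth 0) !inordK //= !mulr1 => p1 q1 p2 q2.
  exists x', y', h'; split=> //.
  have [||z1 z2] := lin (x' * A2.[x] - A0.[x]) (x' * B2.[x] - B0.[x]).
  - transitivity (x' * (A2.[x] + B2.[x] * y) - (A0.[x] + B0.[x] * y)); first by ring.
    by rewrite p1 q1; ring.
  - transitivity (x' * (A2.[x] + B2.[x] * neg_y W x y)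
      - (A0.[x] + B0.[x] * neg_y W x y)); first by ring.
    by rewrite p2 q2; ring.
  by split; apply/eqP; rewrite -subr_eq0 ?z1 ?z2.
have [A [B [B_neq0 map_phi]]] : exists A B : {poly L}, B != 0 /\
    abscissa_map phi (D * B) A B.
  have [a20|a20] := eqVneq A2 0; last first.
    exists A0, A2; split=> // x y h; rewrite hornerM mulf_eq0 negb_or.
    move=> /andP[/(key _ _ h)]/[swap] -> /(_ isT)[x' [y' [h' [e [e' _]]]]].
    by exists x', y', h'.
  exists B0, B2; split; first by apply/eqP => b20; apply: nz.
  move=> x y h; rewrite hornerM mulf_eq0 negb_or.
  move=> /andP[/(key _ _ h)]/[swap] ->; rewrite orbT.
  by move=> /(_ isT)[x' [y' [h' [e [_ e']]]]]; exists x', y', h'.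
exists (D * B), A, B; split=> //; first by rewrite mulf_neq0.
(* With [size A <= size B] the quotient [x'] would stay bounded as [x] tends to infinity, against
   [near]. The multiplier given to [near] makes its product with [x'^-1] a unit times a power of
   [x]. *)
rewrite ltnNge; apply/negP => sAB.
have [SB hSB] := poly_at_infinity_unit Oval B_neq0.
have [S hS] := near [:: lead_coef A / lead_coef B].
have sA : exists SA, forall x, x != 0 -> small O SA x^-1 -> A != 0 ->
    let e := A.[x] / (lead_coef A * x ^+ (size A).-1) in
    [/\ A.[x] != 0, e != 0, e \notin maxid O & e^-1 \notin maxid O].
  have [->|A_neq0] := eqVneq A 0; first by exists [::] => x _ _ /eqP.
  by have [SA hSA] := poly_at_infinity_unit Oval A_neq0; exists SA => x x0 xS _;
    apply: hSA.
have [SA hSA] := sA.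
have [x [x0 /small_cons[x1 /small_cat[xS /small_cat[xSA xSB]]] Dx]] :=
  large (D * B) (mulf_neq0 D0 B_neq0) (1 :: S ++ SA ++ SB).
have [y h] := exists_ordinate W x.
have [x' [y' [h' [eh e']]]] := map_phi x y h Dx.
have [x'0 /small_cons[m _]] := (hS _ _ h x0 xS).2 _ _ _ eh.
have [Bx eB eBm eBVm] := hSB x x0 xSB.
have A_neq0 : A != 0.
  apply: contraTneq (mulf_neq0 x'0 Bx) => A_eq0.
  by rewrite e' A_eq0 horner0 eqxx.
have [Ax eA eAm eAVm] := hSA x x0 xSA A_neq0.
have lA : lead_coef A != 0 by rewrite lead_coef_eq0.
have lB : lead_coef B != 0 by rewrite lead_coef_eq0.
move: m; apply/negP.
have -> : lead_coef A / lead_coef B * x'^-1 =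
    B.[x] / (lead_coef B * x ^+ (size B).-1)
    * (A.[x] / (lead_coef A * x ^+ (size A).-1))^-1
    * x ^+ ((size B).-1 - (size A).-1).
  have -> : x' = A.[x] / B.[x] by rewrite -e' mulfK.
  have -> : x ^+ (size B).-1
      = x ^+ ((size B).-1 - (size A).-1) * x ^+ (size A).-1.
    by rewrite -exprD subnK //; case: (size A) (size B) sAB => [|?] [|?].
  by field; rewrite lA lB Ax Bx !expf_neq0.
apply: (maxid_unitM Oval); first exact: (maxid_unitM Oval).
elim: (_ - _)%N => [|n IH]; first by rewrite expr0 maxid1.
rewrite exprS; apply: (maxid_unitM Oval) => //.
apply: contra (maxid1 O) => xm; rewrite -(divff x0).
by apply: maxid_mulr => //; move: x1; rewrite mul1r => /maxid_int.
Qed.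

End EndomorphismAbscissa.

(** * Existence of valuation rings by Chevalley's argument *)

Section Chevalley.
Variable L : fieldType.

Record ideal_of (R I : {pred L}) : Prop := IdealOf {
  ideal_of_sub : {subset I <= R};
  ideal_of0 : 0 \in I;
  ideal_ofD : {in I &, forall x y, x + y \in I};
  ideal_ofM : forall a x, a \in R -> x \in I -> a * x \in I;
  ideal_of1 : 1 \notin I }.

(* The carriers are functions to bool rather than {pred L}, which would live
   in too large a universe for Zorn's lemma. *)
Record local_pair := LocalPair {
  lp_ring_fun : L -> bool;
  lp_ideal_fun : L -> bool;
  lp_subring : subring_closed (lp_ring_fun : {pred L});
  lp_idealP : ideal_of lp_ring_fun lp_ideal_fun }.

Definition lp_ring (s : local_pair) : {pred L} := lp_ring_fun s.
Definition lp_ideal (s : local_pair) : {pred L} := lp_ideal_fun s.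

HB.instance Definition _ (s : local_pair) :=
  GRing.isSubringClosed.Build L (lp_ring s) (lp_subring s).

Lemma lp_sub s : {subset lp_ideal s <= lp_ring s}.
Proof. exact: ideal_of_sub (lp_idealP s). Qed.

Lemma lp_ideal0 s : 0 \in lp_ideal s.
Proof. exact: ideal_of0 (lp_idealP s). Qed.

Lemma lp_idealD s : {in lp_ideal s &, forall x y, x + y \in lp_ideal s}.
Proof. exact: ideal_ofD (lp_idealP s). Qed.

Lemma lp_idealM s a x : a \in lp_ring s -> x \in lp_ideal s ->
  a * x \in lp_ideal s.
Proof. exact: ideal_ofM (lp_idealP s) _ _. Qed.

Lemma lp_ideal1 s : 1 \notin lp_ideal s.
Proof. exact: ideal_of1 (lp_idealP s). Qed.

Lemma lp_ideal_sum (s : local_pair) (I : finType) (P : pred I) (F : I -> L) :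
  (forall i, P i -> F i \in lp_ideal s) -> \sum_(i | P i) F i \in lp_ideal s.
Proof.
move=> h; elim/big_rec: _ => [|i x /h Fi xI]; first exact: lp_ideal0.
exact: lp_idealD.
Qed.

Definition over_ideal (s : local_pair) (f : {poly L}) :=
  forall i, f`_i \in lp_ideal s.

(* Relations f(x) = 1 and g(1/x) = 1 of degrees n >= m combine, by eliminating
   the leading term of f, into one of degree < n in x. *)
Lemma over_ideal_reduce (s : local_pair) (f g : {poly L}) (x : L) (n : nat) :
  x != 0 -> over_ideal s f -> over_ideal s g -> (size f <= n.+1)%N ->
  (size g <= n.+1)%N -> (0 < n)%N -> f.[x] = 1 -> g.[x^-1] = 1 ->
  exists f', [/\ over_ideal s f', (size f' <= n)%N & f'.[x] = 1].
Proof.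
move=> x0 fI gI sf sg n0 fx gx.
(* Let g_0 be the constant term of [g]. Without it, [g] reversed turns [g.[x^-1] = 1] into [h.[x] =
   (1 - g_0) x^n], which replaces the top term of [f] after multiplication by 1 - g_0; adding g_0
   restores the value 1. *)
pose h := \poly_(k < n) g`_(n - k).
have hI : over_ideal s h.
  by move=> i; rewrite coef_poly; case: ifP => _; [apply: gI|apply: lp_ideal0].
have hx : h.[x] = (1 - g`_0) * x ^+ n.
  rewrite -gx (horner_coef_wide _ sg) big_ord_recl expr0 mulr1 addrC addKr.
  rewrite (horner_coef_wide _ (size_poly _ _)) (reindex_inj rev_ord_inj) /=.
  rewrite big_distrl /=; apply: eq_bigr => i _.
  rewrite coef_poly rev_ord_proof /bump /= add1n subKn; last exact: ltn_ord.
  rewrite -mulrA exprVn; congr (_ * _); apply: (mulfI (expf_neq0 i.+1 x0)).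
  by rewrite mulVKf ?expf_neq0 // -exprD subnKC.
exists ((g`_0)%:P + (1 - g`_0) *: take_poly n f + f`_n *: h); split.
- move=> i; rewrite !coefD !coefZ coefC coef_take_poly.
  have aR : 1 - g`_0 \in lp_ring s by rewrite rpredB ?rpred1 ?(lp_sub (gI _)).
  apply: lp_idealD; last by apply: lp_idealM => //; apply: lp_sub.
  apply: lp_idealD; first by case: ifP => _ //; apply: lp_ideal0.
  apply: lp_idealM => //; case: ifP => _ //; exact: lp_ideal0.
- apply: leq_trans (size_polyD _ _) _; rewrite geq_max.
  rewrite (leq_trans (size_scale_leq _ _)) ?size_poly // andbT.
  apply: leq_trans (size_polyD _ _) _; rewrite geq_max.
  rewrite (leq_trans (size_scale_leq _ _)) ?size_take_poly // andbT.
  by rewrite (leq_trans (size_polyC_leq1 _)).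
have fE : (take_poly n f).[x] = 1 - f`_n * x ^+ n.
  rewrite -fx (horner_coef_wide _ sf) big_ord_recr /= addrK.
  rewrite (horner_coef_wide _ (size_take_poly _ _)); apply: eq_bigr => i _.
  by rewrite coef_take_poly ltn_ord.
rewrite !(hornerD, hornerZ, hornerC) fE hx; ring.
Qed.

(** Descent on the sum of the sizes: the larger polynomial, after exchanging [x] and its inverse if
    needed, is shortened until it is constant, which puts 1 into the ideal. *)
Lemma no_two_relations (s : local_pair) (f g : {poly L}) (x : L) : x != 0 ->
  over_ideal s f -> over_ideal s g -> f.[x] = 1 -> g.[x^-1] = 1 -> False.
Proof.
have [N] := ubnP (size f + size g); elim: N f g x => // N IH f g x.
wlog sgf : f g x / (size g <= size f)%N => [hwlog|] /ltnSE sN x0 fI gI fx gx.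
  have [sgf|/ltnW sfg] := leqP (size g) (size f); first exact: (hwlog f g x).
  by apply: (hwlog g f x^-1); rewrite ?invr_eq0 ?invrK // addnC.
have [sf|sf] := leqP (size f) 1.
  have := lp_ideal1 s; rewrite -fx (size1_polyC sf) hornerC.
  by rewrite fI.
have n0 : (0 < (size f).-1)%N by case: (size f) sf => [|[]].
have eS : (size f).-1.+1 = size f by case: (size f) sf.
have [||f' [f'I sf' f'x]] := over_ideal_reduce x0 fI gI _ _ n0 fx gx.
- by rewrite eS.
- by rewrite eS.
apply: (IH f' g x) => //; apply: leq_trans sN.
by rewrite ltn_add2r -eS ltnS.
Qed.

Section Adjoin.
Variables (s : local_pair) (x : L).

Definition adjoin_ring : {pred L} :=
  fun z => `[< exists2 f, f \is a polyOver (lp_ring s) & z = f.[x] >].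

Definition adjoin_ideal : {pred L} :=
  fun z => `[< exists2 f, over_ideal s f & z = f.[x] >].

Lemma adjoin_subring : subring_closed adjoin_ring.
Proof.
split; first by apply/asboolP; exists 1; rewrite ?rpred1 ?hornerC.
- move=> _ _ /asboolP[f fR ->] /asboolP[g gR ->]; apply/asboolP.
  by exists (f - g); rewrite ?rpredB // hornerD hornerN.
- move=> _ _ /asboolP[f fR ->] /asboolP[g gR ->]; apply/asboolP.
  by exists (f * g); rewrite ?rpredM // hornerM.
Qed.

Lemma adjoin_pair : ~ (exists2 f, over_ideal s f & f.[x] = 1) ->
  exists t : local_pair, [/\ {subset lp_ring s <= lp_ring t},
    {subset lp_ideal s <= lp_ideal t} & x \in lp_ring t].
Proof.
move=> no.
have sub : {subset adjoin_ideal <= adjoin_ring}.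
  move=> _ /asboolP[f fI ->]; apply/asboolP; exists f => //.
  by apply/polyOverP => i; apply: lp_sub.
have I0 : 0 \in adjoin_ideal.
  by apply/asboolP; exists 0; rewrite ?horner0 // => i; rewrite coef0 lp_ideal0.
have ID : {in adjoin_ideal &, forall a b, a + b \in adjoin_ideal}.
  move=> _ _ /asboolP[f fI ->] /asboolP[g gI ->]; apply/asboolP.
  exists (f + g); rewrite ?hornerD // => i; rewrite coefD; exact: lp_idealD.
have IM a b : a \in adjoin_ring -> b \in adjoin_ideal -> a * b \in adjoin_ideal.
  move=> /asboolP[f /polyOverP fR ->] /asboolP[g gI ->]; apply/asboolP.
  exists (f * g); rewrite ?hornerM // => i; rewrite coefM.
  by apply: lp_ideal_sum => k _; apply: lp_idealM.
have I1 : 1 \notin adjoin_ideal.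
  by apply/negP => /asboolP[f fI e]; apply: no; exists f.
exists (LocalPair adjoin_subring (IdealOf sub I0 ID IM I1)); split=> /=.
- move=> z zR; apply/asboolP; exists z%:P; rewrite ?hornerC //.
  by rewrite polyOverC.
- move=> z zI; apply/asboolP; exists z%:P; rewrite ?hornerC // => i.
  by rewrite coefC; case: ifP => _ //; apply: lp_ideal0.
- by apply/asboolP; exists 'X; rewrite ?hornerX ?polyOverX.
Qed.

End Adjoin.

Definition lp_le (s t : local_pair) : bool :=
  `[< {subset lp_ring s <= lp_ring t} /\ {subset lp_ideal s <= lp_ideal t} >].

Section ChainUnion.
Variable A : classical_sets.set local_pair.
Hypothesis chain : classical_sets.total_on A lp_le.
Variable s0 : local_pair.
Hypothesis As0 : A s0.

Definition union_ring : {pred L} := fun z => `[< exists2 s, A s & z \in lp_ring s >].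
Definition union_ideal : {pred L} :=
  fun z => `[< exists2 s, A s & z \in lp_ideal s >].

Lemma chain_bound s t : A s -> A t -> exists u, [/\ A u, lp_le s u & lp_le t u].
Proof.
move=> As At; have [st|ts] := chain As At; [exists t|exists s];
by split=> //; apply/asboolP; split.
Qed.

Lemma union_subring : subring_closed union_ring.
Proof.
split; first by apply/asboolP; exists s0; rewrite ?rpred1.
- move=> x y /asboolP[s As xs] /asboolP[t At yt]; apply/asboolP.
  have [u [Au /asboolP[su _] /asboolP[tu _]]] := chain_bound As At.
  by exists u => //; apply: rpredB; [exact: su|exact: tu].
- move=> x y /asboolP[s As xs] /asboolP[t At yt]; apply/asboolP.
  have [u [Au /asboolP[su _] /asboolP[tu _]]] := chain_bound As At.
  by exists u => //; apply: rpredM; [exact: su|exact: tu].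
Qed.

Lemma chain_upper_bound : exists t, forall s, A s -> lp_le s t.
Proof.
have sub : {subset union_ideal <= union_ring}.
  by move=> z /asboolP[s As zs]; apply/asboolP; exists s => //; apply: lp_sub.
have I0 : 0 \in union_ideal by apply/asboolP; exists s0; rewrite ?lp_ideal0.
have ID : {in union_ideal &, forall a b, a + b \in union_ideal}.
  move=> x y /asboolP[s As xs] /asboolP[t At yt]; apply/asboolP.
  have [u [Au /asboolP[_ su] /asboolP[_ tu]]] := chain_bound As At.
  by exists u => //; apply: lp_idealD; [exact: su|exact: tu].
have IM a b : a \in union_ring -> b \in union_ideal -> a * b \in union_ideal.
  move=> /asboolP[s As xs] /asboolP[t At yt]; apply/asboolP.
  have [u [Au /asboolP[su _] /asboolP[_ tu]]] := chain_bound As At.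
  by exists u => //; apply: lp_idealM; [exact: su|exact: tu].
have I1 : 1 \notin union_ideal.
  by apply/negP => /asboolP[s _]; apply/negP; apply: lp_ideal1.
exists (LocalPair union_subring (IdealOf sub I0 ID IM I1)) => s As; apply/asboolP.
by split=> z zs; apply/asboolP; exists s.
Qed.

End ChainUnion.

(** In a maximal pair, an [x] outside the ring satisfies a relation [f.[x] = 1] over the ideal,
    since adjoining it fails for no other reason; [no_two_relations] forbids this for both [x] and
    its inverse. *)
Theorem exists_valuation_ring (s : local_pair) : exists O : subringClosed L,
  [/\ forall x, x \in O \/ x^-1 \in O, {subset lp_ring s <= O}
    & {subset lp_ideal s <= maxid O}].
Proof.
pose above := {t : local_pair | lp_le s t}.
pose le (t u : above) := lp_le (val t) (val u).
have le_refl t : lp_le t t by apply/asboolP; split.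
have le_trans t u v : lp_le t u -> lp_le u v -> lp_le t v.
  move=> /asboolP[h1 h2] /asboolP[h3 h4]; apply/asboolP.
  by split=> z; [move/h1/h3|move/h2/h4].
have [||A chA|[t st] tmax] := @classical_sets.ZL_preorder above (exist _ s (le_refl s)) le.
- by move=> t; apply: le_refl.
- by move=> t u v; apply: le_trans.
- have [[t At]|none] := pselect (exists t, A t); last first.
    by exists (exist _ s (le_refl s)) => t At; case: none; exists t.
  pose B (u : local_pair) := exists2 v : above, A v & val v = u.
  have chB : classical_sets.total_on B lp_le.
    by move=> _ _ [u Au <-] [v Av <-]; apply: chA.
  have [u hu] := chain_upper_bound chB (ex_intro2 _ _ t At erefl).
  have su : lp_le s u by apply: le_trans (valP t) _; apply: hu; exists t.
  by exists (exist _ u su) => v Av; apply: hu; exists v.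
have max u : lp_le t u -> lp_le u t.
  move=> tu; have su := le_trans _ _ _ st tu.
  exact: (tmax (exist _ u su) tu).
have rel x : x \notin lp_ring t -> exists2 f, over_ideal t f & f.[x] = 1.
  move=> xt; apply: contrapT => /adjoin_pair[u [tu tu' xu]].
  have /asboolP[ut _] : lp_le u t by apply: max; apply/asboolP.
  by rewrite ut in xt.
have /asboolP[st1 st'] := st; exists [the subringClosed L of lp_ring t].
split=> // [x|z zs].
  case: (boolP (x \in lp_ring t)) => [|xt]; [by left|right].
  apply: contraT => xVt; have [f fI fx] := rel x xt; have [g gI gx] := rel _ xVt.
  have x0 : x != 0 by apply: contraNneq xt => ->; rewrite rpred0.
  by have := no_two_relations x0 fI gI fx gx.
have zI := st' z zs; rewrite maxidE (lp_sub zI) /=.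
have [//|z0 /=] := eqVneq z 0; apply: contra (lp_ideal1 t) => zV.
by rewrite -(mulVf z0) lp_idealM.
Qed.

End Chevalley.

(** * Primitive fractions at a prime of the ring of integers *)

Section PrimeOfIntegers.
Variable K : fieldExtType rat.
Local Notation OK := (ring_of_integers K).

Lemma int_valB (x y : OK) : int_val (x - y) = int_val x - int_val y.
Proof. by []. Qed.
Lemma int_valM (x y : OK) : int_val (x * y) = int_val x * int_val y.
Proof. by []. Qed.

HB.instance Definition _ :=
  GRing.isZmodMorphism.Build OK K (@int_val K) int_valB.
HB.instance Definition _ :=
  GRing.isMonoidMorphism.Build OK K (@int_val K) (conj (erefl _) int_valM).

Lemma int_val_inj : injective (@int_val K).
Proof. exact: val_inj. Qed.

Lemma alg_intP (x : K) : x \in @alg_int K -> exists a : OK, int_val a = x.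
Proof. by move=> h; exists (RingOfIntegers h). Qed.

(** With leading coefficient [c] and degree [n], multiplying [f(x) = 0] by [c^(n-1)] gives a monic
    equation for [c x], the polynomial [g] below. *)
Lemma alg_int_lead (f : {poly OK}) (x : K) : f != 0 ->
  root (map_poly (@int_val K) f) x ->
  exists d : OK, int_val d = int_val (lead_coef f) * x.
Proof.
move=> f0 /eqP fx; apply: alg_intP; set c := lead_coef f.
have c0 : int_val c != 0.
  by rewrite -(rmorph0 (@int_val K)) (inj_eq int_val_inj) lead_coef_eq0.
pose n := (size f).-1.
have sf : size f = n.+1 by rewrite /n prednK // size_poly_gt0.
have fE : \sum_(i < n) int_val f`_i * x ^+ i + int_val c * x ^+ n = 0.
  rewrite -[RHS]fx (@horner_coef_wide _ n.+1); last first.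
    by rewrite (size_map_inj_poly int_val_inj) ?sf ?rmorph0.
  rewrite big_ord_recr /= coef_map; congr (_ + _).
  by apply: eq_bigr => i _; rewrite coef_map.
have n0 : (0 < n)%N.
  rewrite lt0n; apply: contraNneq c0 => n0; move: fE; rewrite n0 big_ord0 add0r.
  by rewrite expr0 mulr1 => ->.
pose h : {poly K} := \poly_(i < n) int_val (f`_i * c ^+ (n.-1 - i)).
pose g : {poly K} := 'X^n + h; pose X : {poly K} := 'X^n.
have sg : (size h < size X)%N.
  by rewrite size_polyXn ltnS size_poly.
apply/asboolP; apply: (@integral_root_monic _ _ _ _ g).
- by rewrite monicE lead_coefDl // lead_coefXn.
- rewrite /root hornerD hornerXn horner_poly exprMn -(prednK n0) exprS -mulrA.
  have e (i : 'I_n) : int_val (f`_i * c ^+ (n.-1 - i)) * (int_val c * x) ^+ i =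
      int_val c ^+ n.-1 * (int_val f`_i * x ^+ i).
    have -> : int_val c ^+ n.-1 = int_val c ^+ (n.-1 - i) * int_val c ^+ i.
      by rewrite -exprD subnK // -ltnS prednK.
    by rewrite int_valM rmorphXn /= exprMn; ring.
  rewrite prednK //.
  transitivity (int_val c ^+ n.-1 *
     (\sum_(i < n) int_val f`_i * x ^+ i + int_val c * x ^+ n) == 0); last first.
    by rewrite fE mulr0 eqxx.
  rewrite mulrDr big_distrr /= (eq_bigr _ (fun i _ => e i)) addrC mulrCA !mulrA.
  by [].
- move=> _ /(nthP 0)[i _ <-].
  rewrite coefD coefXn coef_poly; apply: integral_add.
    by case: eqP => _; [apply: integral1|apply: integral0].
  case: ifP => _; last exact: integral0.
  by move: (_ * _) => [z hz] /=; apply/asboolP.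
Qed.

Variable p : prime_idealr OK.

(* Kronecker's trick: a leading coefficient c in p with c x in p can be removed,
   lowering the degree. *)
Lemma primitive_fraction_of_root (f : {poly OK}) (x : K) :
  (exists i, f`_i \notin p) -> root (map_poly (@int_val K) f) x ->
  exists a b : OK, int_val a = int_val b * x /\ (a \notin p) || (b \notin p).
Proof.
have [N] := ubnP (size f); elim: N f => // N IH f /ltnSE sN [i fi] fx.
have f0 : f != 0 by apply: contraNneq fi => ->; rewrite coef0 idealr0.
have [d ed] := alg_int_lead f0 fx; set c := lead_coef f in ed.
case: (boolP ((d \notin p) || (c \notin p))) => [h|]; first by exists d, c.
rewrite negb_or !negbK => /andP[dp cp].
pose n := (size f).-1.
have sf : size f = n.+1 by rewrite /n prednK // size_poly_gt0.
have c0 : int_val c != 0.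
  by rewrite -(rmorph0 (@int_val K)) (inj_eq int_val_inj) lead_coef_eq0.
have n0 : (0 < n)%N.
  rewrite lt0n; apply: contraNneq c0 => n0; move: fx.
  have /size1_polyC -> : (size f <= 1)%N by rewrite sf n0.
  rewrite map_polyC /root hornerC /= => /eqP e0.
  by rewrite /c lead_coefE -/n n0 e0.
(* As [d = c x], the root is kept; as [c] and [d] are in [p], so is a coefficient outside [p]. *)
pose g := f - c *: 'X^n + d *: 'X^(n.-1).
have gE k : g`_k = f`_k - (if k == n then c else 0) + (if k == n.-1 then d else 0).
  rewrite coefD coefB !coefZ !coefXn.
  by do 2![case: eqP => _]; rewrite ?mulr1 ?mulr0.
have tp (b : bool) (e : OK) : e \in p -> (if b then e else 0) \in p.
  by move=> ep; case: b => //; apply: idealr0.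
apply: (IH g).
- apply: leq_trans sN; rewrite sf ltnS; apply/leq_sizeP => k; rewrite leq_eqVlt.
  rewrite gE => /orP[/eqP <-|nk].
    by rewrite eqxx /c lead_coefE -/n subrr add0r -{1}(prednK n0) gtn_eqF.
  rewrite nth_default ?sf // gtn_eqF // gtn_eqF ?subr0 ?addr0 //.
  by apply: leq_ltn_trans (leq_pred _) nk.
- exists i; rewrite gE; apply: contra fi => h.
  have -> : f`_i = (f`_i - (if i == n then c else 0) + (if i == n.-1 then d else 0))
     + (if i == n then c else 0) - (if i == n.-1 then d else 0) by ring.
  by apply: rpredB; [apply: rpredD => //|]; apply: tp.
rewrite /root /g !(rmorphD, rmorphN) /= !map_polyZ !map_polyXn.
rewrite !(hornerD, hornerN, hornerZ, hornerXn) (eqP fx) sub0r /= ed.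
by rewrite -mulrA -exprS prednK // addNr.
Qed.

Lemma nat_gcd_in_ideal m n : m%:R \in p -> n%:R \in p -> (gcdn m n)%:R \in p.
Proof.
case: m => [|m]; first by rewrite gcd0n.
move=> mp np; have [u v e _] := egcdnP n (ltn0Sn m).
have -> : (gcdn m.+1 n)%:R = u%:R * m.+1%:R - v%:R * n%:R :> OK.
  by rewrite -!natrM e natrD addrAC subrr add0r.
by rewrite rpredB // idealMr.
Qed.

Lemma intr_neq0 (z : int) : ((z%:~R : K) == 0) = (z == 0).
Proof. by rewrite -(rmorph_int (GRing.in_alg K)) fmorph_eq0 intr_eq0. Qed.

(** This says that the localization at [p] is a valuation ring. The primitive integral multiple of
    the minimal polynomial has coefficients of gcd 1, so they are not all in [p], and
    [primitive_fraction_of_root] applies. *)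
Lemma primitive_fraction (x : K) :
  exists a b : OK, int_val a = int_val b * x /\ (a \notin p) || (b \notin p).
Proof.
have [q eq] := polyOver1P (minPolyOver 1 x).
have [r [a a0 er]] := rat_poly_scale q.
have q0 : q != 0.
  have := monic_minPoly 1 x; rewrite eq; apply: contraTneq => ->.
  by rewrite rmorph0 monicE lead_coef0 eq_sym oner_eq0.
have r0 : r != 0.
  by apply: contraNneq q0 => e; rewrite er e rmorph0 scaler0.
pose s := zprimitive r.
have rx : root (map_poly (intr : int -> K) r) x.
  have := root_minPoly 1 x; rewrite eq er.
  rewrite map_polyZ -map_poly_comp /root hornerZ mulf_eq0 fmorph_eq0.
  rewrite invr_eq0 intr_eq0 (negPf a0) /=.
  rewrite (@eq_map_poly _ _ _ (intr : int -> K)) // => z /=.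
  exact: (rmorph_int (GRing.in_alg K)).
have sx : root (map_poly (intr : int -> K) s) x.
  move: rx; rewrite {1}[r]zpolyEprim map_polyZ /root hornerZ mulf_eq0.
  by rewrite /= intr_neq0 zcontents_eq0 (negPf r0).
apply: (@primitive_fraction_of_root (map_poly intr s)); last first.
  rewrite -map_poly_comp (@eq_map_poly _ _ _ (intr : int -> K)) // => z /=.
  exact: (rmorph_int (@int_val K)).
apply: contrapT => /forallNP none.
have {}none i : (absz (s`_i))%:R \in p.
  have := none i; rewrite coef_map => /negP/negbNE /=.
  case: (s`_i) => m; rewrite ?NegzE ?abszN //=.
  by rewrite mulrNz rpredN.
pose d := \big[gcdn/0%N]_(i < size s) absz (s`_i).
have dp : d%:R \in p.
  rewrite /d; elim/big_rec: _ => [|i m _ mp]; first exact: idealr0.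
  exact: nat_gcd_in_ideal.
have : d = 1%N.
  have := zcontents_primitive r; rewrite r0 -/s /zcontents -/d => /(congr1 absz).
  rewrite abszM absz_sg lead_coef_eq0 -zcontents_eq0 zcontents_primitive r0.
  by rewrite mul1n.
by move=> d1; move: dp; rewrite d1 idealr1.
Qed.

End PrimeOfIntegers.

(** * Partial derivatives of the homogeneous equation *)

Section WeierstrassPartials.
Variables (R : comNzRingType) (W : weierstrass R).

Definition wpartial (i : nat) (X Y Z : R) : R :=
  match i with
  | 0 => wa1 W * Y * Z - 3%:R * X ^+ 2 - 2%:R * wa2 W * X * Z - wa4 W * Z ^+ 2
  | 1 => 2%:R * Y * Z + wa1 W * X * Z + wa3 W * Z ^+ 2
  | _ => Y ^+ 2 + wa1 W * X * Y + 2%:R * wa3 W * Y * Z - wa2 W * X ^+ 2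
         - 2%:R * wa4 W * X * Z - 3%:R * wa6 W * Z ^+ 2
  end.

Lemma mderiv_XU (n : nat) (i k : 'I_n) :
  mderiv i ('X_k : {mpoly R[n]}) = (i == k)%:R%:MP.
Proof.
rewrite mderivX mnm1E eq_sym; case: eqP => [->|_]; last by rewrite scale0r mpolyC0.
rewrite scale1r (_ : (U_(k) - U_(k))%MM = 0%MM) ?mpolyX0 ?mpolyC1 //.
by apply/mnmP => l; rewrite mnmBE mnm0E subnn.
Qed.

Lemma meval_mderiv_wpoly (i : 'I_3) (u : 'I_3 -> R) :
  (mderiv i (wpoly W)).@[u] = wpartial i (u (inord 0)) (u (inord 1)) (u (inord 2)).
Proof.
rewrite /wpoly !exprS !expr0 !mulr1.
rewrite !(mderivD, mderivB, mderivN, mderivZ, mderivM, mderiv_XU).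
rewrite !(mevalD, mevalB, mevalN, mevalZ, mevalM, mevalC, mevalXU).
by case: i => -[|[|[|//]]] lt3; rewrite -!val_eqE /= !inordK //=; ring.
Qed.

End WeierstrassPartials.

Lemma wpartial_map (R S : comNzRingType) (f : {rmorphism R -> S})
    (W : weierstrass R) i X Y Z :
  wpartial (wmap f W) i (f X) (f Y) (f Z) = f (wpartial W i X Y Z).
Proof.
case: i => [|[|i]] /=;
by rewrite !(rmorph_nat, rmorphXn, rmorphB, rmorphD, rmorphM).
Qed.

(** * Addition and base change *)

Section AddAffine.
Variables (L : fieldType) (W : weierstrass L) (x1 y1 x2 y2 : L).
Variables (h1 : weqn W x1 y1) (h2 : weqn W x2 y2).

Lemma add_Aff_inf : (x1 == x2) && (y1 == neg_y W x2 y2) ->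
  add_point (Aff h1) (Aff h2) = Inf.
Proof. by move=> c; rewrite /=; destruct (boolP _) as [c'|c'] => //; case/negP: (c'). Qed.

Lemma add_Aff (c : ~~ ((x1 == x2) && (y1 == neg_y W x2 y2))) :
  add_point (Aff h1) (Aff h2) = Aff (weqn_add h1 h2 c).
Proof.
rewrite /=; destruct (boolP _) as [c'|c']; first by case/negP: (c).
exact: Aff_eq.
Qed.

End AddAffine.

Section BaseChangeAdd.
Variables (K L : fieldType) (j : {rmorphism K -> L}) (W : weierstrass K).

Lemma slope_map x1 y1 x2 y2 :
  slope (wmap j W) (j x1) (j y1) (j x2) (j y2) = j (slope W x1 y1 x2 y2).
Proof.
rewrite /slope (inj_eq (fmorph_inj j)) /=; case: ifP => _.
  rewrite fmorph_div.
  by rewrite !(rmorph_nat, rmorphXn, rmorphB, rmorphD, rmorphM).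
by rewrite fmorph_div !rmorphB.
Qed.

Lemma add_x_map x1 y1 x2 y2 :
  add_x (wmap j W) (j x1) (j y1) (j x2) (j y2) = j (add_x W x1 y1 x2 y2).
Proof. by rewrite /add_x slope_map !(rmorphXn, rmorphB, rmorphD, rmorphM). Qed.

Lemma neg_y_map x y : neg_y (wmap j W) (j x) (j y) = j (neg_y W x y).
Proof. by rewrite /neg_y !(rmorphB, rmorphN, rmorphM). Qed.

Lemma base_change_opp (P : point W) :
  base_change j (opp_point P) = opp_point (base_change j P).
Proof. by case: P => //= x y h; apply: Aff_eq => //; rewrite neg_y_map. Qed.

Lemma base_change_add (P Q : point W) :
  base_change j (add_point P Q) = add_point (base_change j P) (base_change j Q).
Proof.
case: P Q => [|x1 y1 h1] [|x2 y2 h2] //.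
have e : (j x1 == j x2) && (j y1 == neg_y (wmap j W) (j x2) (j y2))
    = (x1 == x2) && (y1 == neg_y W x2 y2).
  by rewrite neg_y_map !(inj_eq (fmorph_inj j)).
case: (boolP ((x1 == x2) && (y1 == neg_y W x2 y2))) => c.
  by rewrite /base_change !add_Aff_inf // e.
have c' := c; rewrite -e in c'; rewrite (add_Aff _ _ c) /base_change (add_Aff _ _ c').
apply: Aff_eq; first by rewrite add_x_map.
rewrite /add_y add_x_map slope_map -neg_y_map.
move: (slope _ _ _ _ _) (add_x _ _ _ _ _) => l x3.
by rewrite rmorphD rmorphM rmorphB.
Qed.

Lemma wdisc_map : wdisc (wmap j W) = j (wdisc W).
Proof.
by rewrite /wdisc /= !(rmorph_nat, rmorphXn, rmorphD, rmorphB, rmorphN, rmorphM).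
Qed.

End BaseChangeAdd.

(** * Valuation rings above a prime *)

Section ReductionValuation.
Variables (K : fieldExtType rat) (L : fieldType) (j : {rmorphism K -> L}).
Local Notation OK := (ring_of_integers K).
Variable p : prime_idealr OK.

Definition valuation_over (O : subringClosed L) :=
  [/\ forall x, x \in O \/ x^-1 \in O, forall a : OK, j (int_val a) \in O
    & forall a : OK, (j (int_val a) \in maxid O) = (a \in p)].

Lemma int_val_neq0 (b : OK) : b \notin p -> j (int_val b) != 0.
Proof.
move=> bp; rewrite fmorph_eq0; apply: contraNneq bp => b0.
by rewrite (_ : b = 0) ?idealr0 //; apply: int_val_inj.
Qed.

(** The localization of the integers at [p], embedded by [j]; with its maximal ideal it is the
    starting pair for [exists_valuation_ring]. *)
Definition local_ring : {pred L} := fun z =>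
  `[< exists a b : OK, b \notin p /\ z = j (int_val a) / j (int_val b) >].
Definition local_ideal : {pred L} := fun z =>
  `[< exists a b : OK, [/\ a \in p, b \notin p
                       & z = j (int_val a) / j (int_val b)] >].

Lemma notin_primeM (a b : OK) : a \notin p -> b \notin p -> a * b \notin p.
Proof. by move=> ap bp; rewrite prime_idealrM negb_or ap. Qed.

Lemma local_subring : subring_closed local_ring.
Proof.
split.
- apply/asboolP; exists 1, 1; split; first by rewrite idealr1.
  by rewrite !rmorph1 divr1.
- move=> _ _ /asboolP[a [b [bp ->]]] /asboolP[c [d [dp ->]]]; apply/asboolP.
  exists (a * d - c * b), (b * d); split; first exact: notin_primeM.
  have [b0 d0] := (int_val_neq0 bp, int_val_neq0 dp).
  rewrite !(rmorphB, rmorphM) /=; field; by rewrite b0 d0.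
- move=> _ _ /asboolP[a [b [bp ->]]] /asboolP[c [d [dp ->]]]; apply/asboolP.
  exists (a * c), (b * d); split; first exact: notin_primeM.
  have [b0 d0] := (int_val_neq0 bp, int_val_neq0 dp).
  rewrite !rmorphM /=; field; by rewrite b0 d0.
Qed.

Lemma local_ideal_of : ideal_of local_ring local_ideal.
Proof.
split.
- by move=> _ /asboolP[a [b [ap bp ->]]]; apply/asboolP; exists a, b.
- apply/asboolP; exists 0, 1; split; rewrite ?idealr0 ?idealr1 //.
  by rewrite !rmorph0 mul0r.
- move=> _ _ /asboolP[a [b [ap bp ->]]] /asboolP[c [d [cp dp ->]]]; apply/asboolP.
  exists (d * a + b * c), (b * d); split; [|exact: notin_primeM|].
    by rewrite rpredD ?idealMr.
  have [b0 d0] := (int_val_neq0 bp, int_val_neq0 dp).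
  rewrite !(rmorphD, rmorphM) /=; field; by rewrite b0 d0.
- move=> _ _ /asboolP[a [b [bp ->]]] /asboolP[c [d [cp dp ->]]]; apply/asboolP.
  exists (a * c), (b * d); split; [exact: idealMr|exact: notin_primeM|].
  have [b0 d0] := (int_val_neq0 bp, int_val_neq0 dp).
  rewrite !rmorphM /=; field; by rewrite b0 d0.
apply/negP => /asboolP[a [b [ap bp e]]]; have b0 := int_val_neq0 bp.
have eab : j (int_val a) = j (int_val b) by rewrite -[LHS](divfK b0) -e mul1r.
by case/negP: bp; rewrite -(int_val_inj (fmorph_inj j eab)).
Qed.

Lemma exists_valuation_over : exists O, valuation_over O.
Proof.
have [O [Oval RO IO]] := exists_valuation_ring (LocalPair local_subring local_ideal_of).
have one_notin : (1 : OK) \notin p by rewrite idealr1.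
exists O; split=> // a.
  apply: RO; apply/asboolP; exists a, 1; split=> //.
  by rewrite !rmorph1 divr1.
apply/idP/idP => [am|ap]; last first.
  apply: IO; apply/asboolP; exists a, 1; split=> //.
  by rewrite !rmorph1 divr1.
apply: contraT => ap; have a0 := int_val_neq0 ap.
have : (j (int_val a))^-1 \in O.
  apply: RO; apply/asboolP; exists 1, a; split=> //.
  by rewrite !rmorph1 mul1r.
by move: am; rewrite maxidE (negPf a0) /= => /andP[_ /negPf->].
Qed.

Variable O : subringClosed L.
Hypothesis Oover : valuation_over O.
Let Oval : forall x, x \in O \/ x^-1 \in O.
Proof. by case: Oover. Qed.
Let OKO (a : OK) : j (int_val a) \in O.
Proof. by case: Oover. Qed.
Let OKp (a : OK) : (j (int_val a) \in maxid O) = (a \in p).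
Proof. by case: Oover. Qed.

(** In a primitive fraction with [b] in [p], an integral [x] would put [a = b x] into [p] too. *)
Lemma fraction_of_int (x : K) : j x \in O ->
  exists a b : OK, b \notin p /\ int_val a = int_val b * x.
Proof.
move=> xO; have [a [b [e ab]]] := primitive_fraction p x.
exists a, b; split=> //; apply: contraTN xO => bp; rewrite bp orbF in ab.
apply: contra ab => xO; rewrite -OKp e rmorphM /=.
by apply: maxid_mulr; rewrite ?OKp.
Qed.

Variable W : weierstrass OK.
Local Notation WL := (wmap j (curve_of W)).

Lemma wa_int : [/\ wa1 WL \in O, wa2 WL \in O, wa3 WL \in O, wa4 WL \in O
  & wa6 WL \in O].
Proof. by split; apply: OKO. Qed.

Lemma wnonsingular_quot (X : 'I_3 -> OK) :
  wnonsingular (wmap \pi_({ideal_quot p})%qT W) (fun i => \pi_({ideal_quot p})%qT (X i))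
  <-> exists i : 'I_3,
        wpartial W i (X (inord 0)) (X (inord 1)) (X (inord 2)) \notin p.
Proof.
have h (i : 'I_3) : ((mderiv i (wpoly (wmap \pi_({ideal_quot p})%qT W))).@[
    fun i => \pi_({ideal_quot p})%qT (X i)] != 0) =
    (wpartial W i (X (inord 0)) (X (inord 1)) (X (inord 2)) \notin p).
  rewrite meval_mderiv_wpoly wpartial_map; congr negb.
  by rewrite -[wpartial W _ _ _ _ in RHS]subr0 Quotient.idealrBE rmorph0.
by split=> -[i hi]; exists i; rewrite ?h // -h.
Qed.

End ReductionValuation.

(** * The two descriptions of non-singular reduction agree *)

Section NonsingularReduction.
Variables (K : fieldExtType rat) (L : fieldType) (j : {rmorphism K -> L}).
Local Notation OK := (ring_of_integers K).
Variables (p : prime_idealr OK) (O : subringClosed L).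
Hypothesis Oover : valuation_over j p O.
Variable W : weierstrass OK.
Local Notation WL := (wmap j (curve_of W)).

(** The partial derivatives are homogeneous of degree 2. On the curve Euler's relation expresses the
    third through the first two. *)
Lemma wpartial_affine (R : comNzRingType) (V : weierstrass R) (c x y : R) :
  [/\ wpartial V 0 (c * x) (c * y) c = c ^+ 2 *
        (wa1 V * y - 3%:R * x ^+ 2 - 2%:R * wa2 V * x - wa4 V),
      wpartial V 1 (c * x) (c * y) c = c ^+ 2 * (2%:R * y + wa1 V * x + wa3 V)
    & weqn V x y -> wpartial V 2 (c * x) (c * y) c = c ^+ 2 *
        (x * (3%:R * x ^+ 2 + 2%:R * wa2 V * x + wa4 V - wa1 V * y)
         - y * (2%:R * y + wa1 V * x + wa3 V))].
Proof.
split=> /=; [ring|ring|move=> /eqP e].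
have -> : wa6 V = y ^+ 2 + wa1 V * x * y + wa3 V * y - x ^+ 3
  - wa2 V * x ^+ 2 - wa4 V * x by rewrite e; ring.
ring.
Qed.

(** For an integral representative of an affine point, the scaling factor [c] is its third
    coordinate, hence integral; at a singular reduction all three partials are then in [p]. *)
Lemma nonsing_of_nonsingular_reduction (P : point (curve_of W)) :
  nonsingular_reduction p P -> nonsing O (base_change j P).
Proof.
case: Oover => Oval OKO OKp; have [a1O a2O a3O a4O a6O] := wa_int Oover W.
case: P => [//|x y h] [X [[i0 Xi0] [c c0 eX] /wnonsingular_quot[i]]] /=.
apply: contra => /and3P[xO dx dy].
have yO := int_ordinate Oval a1O a2O a3O a4O a6O (weqn_map j h) xO.
have e0 : int_val (X (inord 0)) = c * x.
  by rewrite eX /= (tnth_nth 0) inordK.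
have e1 : int_val (X (inord 1)) = c * y.
  by rewrite eX /= (tnth_nth 0) inordK.
have e2 : int_val (X (inord 2)) = c.
  by rewrite eX /= (tnth_nth 0) inordK //= mulr1.
have cO : j c \in O by rewrite -e2.
have eW : int_val (wpartial W i (X (inord 0)) (X (inord 1)) (X (inord 2)))
    = wpartial (curve_of W) i (c * x) (c * y) c.
  by rewrite -{3}e2 -e1 -e0 (wpartial_map (@int_val K)).
rewrite -OKp [int_val _]eW -(wpartial_map j) !rmorphM.
have [w0 w1 w2] := wpartial_affine WL (j c) (j x) (j y).
have {}w2 := w2 (weqn_map j h).
rewrite -/(wdy WL (j x) (j y)) in w1.
rewrite -/(wdy WL (j x) (j y)) -/(wdx WL (j x) (j y)) in w2.
have jxO := xO; case: i {eW} => -[|[|[|//]]] /= _.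
- rewrite [X in X \in _]w0.
  have -> : wa1 WL * j y - 3%:R * j x ^+ 2 - 2%:R * wa2 WL * j x - wa4 WL
    = - wdx WL (j x) (j y) by rewrite /wdx; ring.
  by in_maxid Oval.
- by rewrite [X in X \in _]w1; in_maxid Oval.
- by rewrite [X in X \in _]w2; in_maxid Oval.
Qed.

Lemma nonsingular_reduction_of_nonsing (P : point (curve_of W)) :
  nonsing O (base_change j P) -> nonsingular_reduction p P.
Proof.
case: Oover => Oval OKO OKp; have [a1O a2O a3O a4O a6O] := wa_int Oover W.
case: P => [_|x y h /= ns].
  exists (tnth [tuple 0; 1; 0]); split.
  - by exists (inord 1); rewrite (tnth_nth 0) inordK //= idealr1.
  - exists 1; first exact: oner_neq0.
    by case=> -[|[|[|//]]] lt3; rewrite !(tnth_nth 0) /= mul1r.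
  apply/wnonsingular_quot; exists (inord 2).
  rewrite !(tnth_nth 0) !inordK //= !(mulr0, mul0r, expr0n) /=.
  by rewrite !(mulr0, addr0, subr0) expr1n idealr1.
have [xO|xO] := boolP (j x \in O).
  have yO := int_ordinate Oval a1O a2O a3O a4O a6O (weqn_map j h) xO.
  have [a [b [bp ea]]] := fraction_of_int Oover xO.
  have [a' [b' [b'p ea']]] := fraction_of_int Oover yO.
  have cp := notin_primeM bp b'p; pose c := int_val (b * b').
  have ec0 : int_val (a * b') = c * x.
    by rewrite /c !rmorphM /= ea; ring.
  have ec1 : int_val (a' * b) = c * y.
    by rewrite /c !rmorphM /= ea'; ring.
  exists (tnth [tuple a * b'; a' * b; b * b']); split.
  - by exists (inord 2); rewrite (tnth_nth 0) inordK.
  - exists c; first by rewrite -(fmorph_eq0 j) (int_val_neq0 j cp).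
    case=> -[|[|[|//]]] lt3; rewrite !(tnth_nth 0) //=.
    by rewrite mulr1.
  apply/wnonsingular_quot.
  have eW i : j (int_val (wpartial W i (a * b') (a' * b) (b * b')))
      = wpartial WL i (j c * j x) (j c * j y) (j c).
    have ec2 : int_val (b * b') = c by [].
    move: (a * b') (a' * b) (b * b') ec0 ec1 ec2 => X0 X1 X2 ec0 ec1 ec2.
    by rewrite -(wpartial_map (@int_val K)) /= ec0 ec1 ec2 -!rmorphM wpartial_map.
  have [w0 w1 _] := wpartial_affine WL (j c) (j x) (j y).
  have cm : j c ^+ 2 \notin maxid O.
    by rewrite expr2; apply: (maxid_unitM Oval); rewrite OKp.
  move: ns; rewrite /singular_red xO /= negb_and => /orP[] ns.
    exists (inord 0); rewrite !(tnth_nth 0) !inordK // -OKp [j _]eW w0.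
    apply: (maxid_unitM Oval) => //; apply: contra ns => /maxid_opp m.
    have -> : wdx WL (j x) (j y) = - (wa1 WL * j y - 3%:R * j x ^+ 2
      - 2%:R * wa2 WL * j x - wa4 WL) by rewrite /wdx; ring.
    exact: m.
  exists (inord 1); rewrite !(tnth_nth 0) !inordK // -OKp [j _]eW w1.
  exact: (maxid_unitM Oval).
(* The point reduces to infinity: in the coordinates [x / y] and [1 / y], both in the maximal ideal,
   the third partial is congruent to the square of the middle coordinate. *)
have [jx0 xm] := notin_int Oval xO.
have [] := ordinate_dominates Oval a1O a2O a3O a4O a6O (c := 1) (weqn_map j h) jx0 xm.
- by rewrite mul1r.
- by rewrite expr1n mul1r.
rewrite !mul1r => jy0 xym ym; have y0 : y != 0 by rewrite -(fmorph_eq0 j).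
rewrite -fmorph_div in xym; rewrite -fmorphV in ym.
have [a [b [bp ea]]] := fraction_of_int Oover (maxid_int xym).
have [a' [b' [b'p ea']]] := fraction_of_int Oover (maxid_int ym).
have ap : a \in p by rewrite -OKp ea rmorphM /= maxid_mull.
have a'p : a' \in p by rewrite -OKp ea' rmorphM /= maxid_mull.
have cp := notin_primeM bp b'p.
exists (tnth [tuple a * b'; b * b'; a' * b]); split.
- by exists (inord 1); rewrite (tnth_nth 0) inordK.
- exists (int_val (b * b') / y).
    by rewrite mulf_neq0 ?invr_eq0 // -(fmorph_eq0 j) (int_val_neq0 j cp).
  case=> -[|[|[|//]]] lt3; rewrite (tnth_nth (0 : OK)) /= (tnth_nth (0 : K)) /=
    ?rmorphM /=.
  + by rewrite ea; field.
  + by field.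
  + by rewrite ea'; field.
apply/wnonsingular_quot; exists (inord 2); rewrite !(tnth_nth 0) !inordK //=.
set u := a * b'; set v := b * b'; set t := a' * b.
have up : u \in p by rewrite /u mulrC idealMr.
have tp : t \in p by rewrite /t mulrC idealMr.
apply: contra (notin_primeM cp cp) => m.
have -> : b * b' * (b * b') = (v ^+ 2 + wa1 W * u * v + 2%:R * wa3 W * v * t
   - wa2 W * u ^+ 2 - 2%:R * wa4 W * u * t - 3%:R * wa6 W * t ^+ 2)
   - ((wa1 W * v - wa2 W * u) * u + (2%:R * wa3 W * v - 2%:R * wa4 W * u
      - 3%:R * wa6 W * t) * t) by rewrite /v; ring.
by rewrite rpredB // rpredD // idealMr.
Qed.

End NonsingularReduction.

(** * The quadratic equation of the generator *)

Section QuadraticOrder.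
Variables (K : fieldExtType rat) (F : {subfield K}) (w : K).

Lemma dim_imaginary_quadratic : imaginary_quadratic F -> (\dim F <= 2)%N.
Proof.
move=> [d [s [_ sd ->]]]; rewrite dim_Fadjoin dimv1 muln1 -ltnS -size_minPoly.
pose q : {poly K} := 'X^2 - (d%:A)%:P.
have sq : size q = 3 by rewrite size_XnsubC.
suff : (size (minPoly 1 s) <= size q)%N by rewrite sq.
apply: dvdp_leq; first by rewrite -size_poly_gt0 sq.
apply: minPoly_dvdp; last by rewrite /root !hornerE sd subrr.
by rewrite rpredB ?polyOverXn // polyOverC memvZ // memv_line.
Qed.

(** Cayley-Hamilton for multiplication by [w] on a Z-basis of the order: in rank two [t] and [n] are
    the trace and the determinant. *)
Lemma quadratic_order_eqn : imaginary_quadratic F -> is_order F (Zadj_pred w) ->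
  exists t n : int, w ^+ 2 = t%:~R * w - n%:~R.
Proof.
move=> /dim_imaginary_quadratic dimF [[O1 OB OM] [b _ bO]].
have wO : w \in Zadj_pred w.
  by apply/asboolP; exists 'X; rewrite map_polyX hornerX.
have bi i : tnth b i \in Zadj_pred w.
  apply/bO; exists (fun k => (k == i)%:R); rewrite (bigD1 i) //= eqxx mulr1z.
  by rewrite big1 ?addr0 // => k /negPf ->; rewrite mulr0z.
have wb i : exists c : 'I_(\dim F) -> int, w * tnth b i = \sum_k tnth b k *~ c k.
  by apply/bO; apply: OM; [exact: wO|exact: bi].
have [c1 e1] : exists c : 'I_(\dim F) -> int, 1 = \sum_k tnth b k *~ c k.
  exact/bO.
have nz : exists i, tnth b i != 0.
  apply: contrapT => /forallNP none; have /eqP[] := oner_neq0 K.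
  rewrite e1 big1 // => i _; have /negP := none i.
  by rewrite negbK => /eqP ->; rewrite mul0rz.
move: (\dim F) dimF b {bO bi c1 e1} wb nz => [|[|[|//]]] _ b wb [i0 nz].
- by have := ltn_ord i0; rewrite ltn0.
(* In rank one [w] is an integer [c], and the equation is [(w - c) ^+ 2 = 0]. *)
- have [c ec] := wb i0; rewrite big_ord1 !ord1 in ec nz.
  have ew : w = (c 0)%:~R.
    apply: (mulIf nz); rewrite [RHS]mulrC mulrzr; rewrite -ec.
    by congr (_ * tnth b _); apply: ord1.
  exists (2%:R * c 0), (c 0 ^+ 2).
  by rewrite rmorphM rmorphXn /= rmorph_nat -ew; ring.
have [c ec] := wb ord0; have [d ed] := wb (lift ord0 ord0).
rewrite !big_ord_recl !big_ord0 !addr0 in ec ed.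
set b0 := tnth b ord0 in ec ed; set b1 := tnth b _ in ec ed.
set c0 := c _ in ec; set c1 := c _ in ec; set d0 := d _ in ed; set d1 := d _ in ed.
have key x : x != 0 -> (x = b0 \/ x = b1) ->
    w ^+ 2 - (c0 + d1)%:~R * w + (c0 * d1 - c1 * d0)%:~R = 0.
  move=> x0 hx; apply: (mulIf x0); rewrite mul0r !(rmorphB, rmorphD, rmorphM) /=.
  have {}ec : (w - c0%:~R) * b0 = c1%:~R * b1.
    by rewrite mulrBl ec -(mulrzl b0) -(mulrzl b1); ring.
  have {}ed : (w - d1%:~R) * b1 = d0%:~R * b0.
    by rewrite mulrBl ed -(mulrzl b0) -(mulrzl b1); ring.
  case: hx => ->.
    transitivity ((w - d1%:~R) * ((w - c0%:~R) * b0) - c1%:~R * (d0%:~R * b0)).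
      by ring.
    by rewrite ec -ed; ring.
  transitivity ((w - c0%:~R) * ((w - d1%:~R) * b1) - d0%:~R * (c1%:~R * b1)).
    by ring.
  by rewrite ed -ec; ring.
exists (c0 + d1), (c0 * d1 - c1 * d0).
apply/eqP; rewrite -subr_eq0; apply/eqP.
rewrite -(key _ nz); first by ring.
by case: i0 {nz} => -[|[|//]] lt; [left|right]; congr (tnth b _); apply: val_inj.
Qed.

End QuadraticOrder.

(** * Rationality of the image of a rational point *)

Section RationalPoints.
Variables (K L : fieldType) (j : {rmorphism K -> L}) (W : weierstrass K).

Lemma weqn_map_inv x y : weqn (wmap j W) (j x) (j y) -> weqn W x y.
Proof.
rewrite /weqn /= => /eqP e; apply/eqP; apply: (fmorph_inj j).
by rewrite !(rmorphXn, rmorphD, rmorphM).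
Qed.

Lemma hcoord_base_change (P : point W) i :
  hcoord (base_change j P) i = j (hcoord P i).
Proof.
case: P => [|x y h] /=; rewrite !(tnth_nth 0);
by case: i => -[|[|[|//]]] /= _; rewrite ?rmorph0 ?rmorph1.
Qed.

(** The local polynomials have coefficients in [K], so their values at a point over [K] are in [K],
    and so are the quotients by the third one. *)
Lemma morphism_rational (phi : point (wmap j W) -> point (wmap j W)) P :
  morphism_over j phi -> exists Q, base_change j Q = phi (base_change j P).
Proof.
move=> /(_ (base_change j P))[d [f [_ ev0 /(_ _ ev0)[c c0 ec]]]].
have {}ec i : j (f i).@[hcoord P] = c * hcoord (phi (base_change j P)) i.
  rewrite -ec; symmetry; apply: meval_map_mpoly => k; exact: hcoord_base_change.
case: (phi _) ec => [|x y h] ec; first by exists Inf.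
have e0 := ec (inord 0); have e1 := ec (inord 1); have e2 := ec (inord 2).
move: e0 e1 e2; rewrite /= !(tnth_nth 0) !inordK //= mulr1 => e0 e1 e2.
have ex : x = j ((f (inord 0)).@[hcoord P] / (f (inord 2)).@[hcoord P]).
  by rewrite fmorph_div e0 e2 mulrC mulKf.
have ey : y = j ((f (inord 1)).@[hcoord P] / (f (inord 2)).@[hcoord P]).
  by rewrite fmorph_div e1 e2 mulrC mulKf.
have h' := h; rewrite ex ey in h'.
by exists (Aff (weqn_map_inv h')); apply: Aff_eq.
Qed.

End RationalPoints.

(** * Induction over the elements of the order *)

Section ZadjVal.
Variables (K : fieldExtType rat) (w : K).

Lemma Zadj_valB (x y : Zadj w) : Zadj_val (x - y) = Zadj_val x - Zadj_val y.
Proof. by []. Qed.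
Lemma Zadj_valM (x y : Zadj w) : Zadj_val (x * y) = Zadj_val x * Zadj_val y.
Proof. by []. Qed.

HB.instance Definition _ :=
  GRing.isZmodMorphism.Build (Zadj w) K (@Zadj_val K w) Zadj_valB.
HB.instance Definition _ := GRing.isMonoidMorphism.Build (Zadj w) K
  (@Zadj_val K w) (conj (erefl _) Zadj_valM).

Lemma Zadj_ind (P : Zadj w -> Prop) (g : Zadj w) : Zadj_val g = w -> P g ->
  (forall n : int, P n%:~R) -> (forall a b, P a -> P b -> P (a + b)) ->
  (forall a b, P a -> P b -> P (a * b)) -> forall a, P a.
Proof.
move=> gw Pg PZ PD PM a.
suff [f ->] : exists f : {poly int}, a = (map_poly intr f).[g].
  elim/poly_ind: f => [|f c IH].
    by rewrite rmorph0 horner0; apply: (PZ 0).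
  rewrite rmorphD rmorphM /= map_polyX map_polyC hornerMXaddC.
  by apply: (PD); [apply: (PM)|apply: (PZ)].
case: a => x hx; have /asboolP[f ef] := hx; exists f.
apply: val_inj; rewrite /= ef.
transitivity (map_poly intr f).[Zadj_val g]; first by rewrite gw.
rewrite -horner_map -map_poly_comp; congr (_.[_]).
by apply: eq_map_poly => z /=; rewrite (rmorph_int (@Zadj_val K w)).
Qed.

End ZadjVal.

(** * Action of integers through the endomorphism ring *)

Section EndomorphismAction.
Variables (L : fieldType) (W : weierstrass L) (A : nzRingType).
Variable theta : A -> point W -> point W.
Hypothesis ell : wdisc W != 0.
Hypotheses (theta1 : forall P, theta 1 P = P)
  (thetaD : forall a b P, theta (a + b) P = add_point (theta a P) (theta b P)).

Lemma theta0 P : theta 0 P = Inf.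
Proof. by apply: add_idem_inf => //; rewrite -thetaD addr0. Qed.

Lemma thetaN a P : theta (- a) P = opp_point (theta a P).
Proof. by apply: opp_inf_eq; rewrite -thetaD subrr theta0. Qed.

Lemma theta_int (N : point W -> bool) : N Inf ->
  (forall P Q, N P -> N Q -> N (add_point P Q)) ->
  (forall P, N P -> N (opp_point P)) ->
  forall (n : int) P, N P -> N (theta n%:~R P).
Proof.
move=> N0 ND NN n P NP.
have Nnat (m : nat) : N (theta m%:R P).
  elim: m => [|m IH]; first by rewrite theta0.
  by rewrite -addn1 natrD thetaD; apply: (ND) => //; rewrite theta1.
case: n => m; first exact: Nnat.
by rewrite NegzE mulrNz thetaN; apply: NN; apply: Nnat.
Qed.

End EndomorphismAction.

(** * Endomorphisms with an integral trace and norm *)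

Section ConjugateEndomorphism.
Variables (k : fieldType) (L : closedFieldType) (j : {rmorphism k -> L}).
Variables (O : subringClosed L) (W : weierstrass L) (A : nzRingType).
Variable theta : A -> point W -> point W.
Hypothesis Oval : forall x, x \in O \/ x^-1 \in O.
Hypothesis maxid_neq0 : exists2 t, t != 0 & t \in maxid O.
Hypothesis two_neq0 : 2%:R != 0 :> L.
Hypotheses (a1O : wa1 W \in O) (a2O : wa2 W \in O) (a3O : wa3 W \in O)
  (a4O : wa4 W \in O) (a6O : wa6 W \in O).
Hypothesis ell : wdisc W != 0.
Hypothesis theta_endo : forall a, endomorphism_over j (theta a).
Hypotheses (theta1 : forall P, theta 1 P = P)
  (thetaD : forall a b P, theta (a + b) P = add_point (theta a P) (theta b P))
  (thetaM : forall a b P, theta (a * b) P = theta a (theta b P)).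

Lemma nonsing_quadratic (g h : A) (t n : int) : g + h = t%:~R -> h * g = n%:~R ->
  forall P, nonsing O P -> nonsing O (theta g P).
Proof.
move=> gh hg; have nD := nonsing_add Oval a1O a2O a3O a4O a6O.
have nN := @nonsing_opp _ _ Oval W a1O.
have kD := kernel_add Oval a1O a2O a3O a4O a6O.
have [_ g0 gD] := theta_endo g; have [_ h0 hD] := theta_endo h.
have ker P : in_kernel O P -> in_kernel O (theta h (theta g P)).
  move=> kP; rewrite -thetaM hg.
  apply: (theta_int ell theta1 thetaD) => //; exact: kernel_opp.
have conj P : nonsing O P -> in_kernel O (theta h P) -> nonsing O (theta g P).
  move=> nP kP; have -> : g = t%:~R - h by rewrite -gh addrK.
  rewrite thetaD (thetaN ell thetaD); apply: (nD).
    exact: (theta_int ell theta1 thetaD _ nD nN).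
  by apply: (nN); apply: nonsing_kernel.
apply: (nonsing_of_generic Oval a1O a2O a3O a4O a6O ell g0 gD).
have [[D D0 Dinf]|[D [A1 [B1 [D0 sBA map_g]]]]] := endomorphism_abscissa
  Oval maxid_neq0 a1O a2O a3O a4O a6O two_neq0 (theta_endo g).
  (* Here [g] sends generic points to [Inf], which has non-singular reduction. *)
  have [rs defD] := closed_field_poly_normal D.
  exists rs => x y hx /avoids_notin xrs; rewrite Dinf //.
  apply: contra xrs => /eqP Dx; rewrite -root_prod_XsubC.
  move: Dx; rewrite {1}defD hornerZ => /eqP.
  by rewrite mulf_eq0 lead_coef_eq0 (negPf D0).
have [D' [A' [B' [D'0 mA' sBA' cop map']]]] :=
  abscissa_map_normalize D0 sBA map_g.
exact: (generic_nonsing Oval a1O a2O a3O a4O a6O ell h0 hD ker conj D'0 mA'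
  sBA' cop map').
Qed.

End ConjugateEndomorphism.

Theorem theorem2p19
  (K : fieldExtType rat)
  (Kbar : closedFieldType) (j : {rmorphism K -> Kbar})
  (Kbar_alg : integralRange j)
  (W : weierstrass (ring_of_integers K))
  (W_elliptic : wdisc (curve_of W) != 0)
  (F : {subfield K}) (F_imq : imaginary_quadratic F)
  (w : K) (w_order : is_order F (Zadj_pred w))
  (theta : Zadj w -> point (wmap j (curve_of W)) ->
           point (wmap j (curve_of W)))
  (CM : is_endomorphism_ring j theta)
  (p : prime_idealr (ring_of_integers K))
  (p_neq0 : exists2 x : ring_of_integers K, x != 0 & x \in p) :
  is_submodule theta (@nonsingular_reduction K W p).
Proof.
have [[endo _ _] [theta1 thetaD thetaM]] := CM.
have [O Oover] := exists_valuation_over j p; have [Oval OKO OKp] := Oover.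
have [a1O a2O a3O a4O a6O] := wa_int Oover W.
have ell : wdisc (wmap j (curve_of W)) != 0 by rewrite wdisc_map fmorph_eq0.
have m0 : exists2 t, t != 0 & t \in maxid O.
  have [x x0 xp] := p_neq0; exists (j (int_val x)); last by rewrite OKp.
  by rewrite fmorph_eq0 -(rmorph0 (@int_val K)) (inj_eq (@int_val_inj K)).
have two0 : 2%:R != 0 :> Kbar.
  by rewrite -(rmorph_nat j) fmorph_eq0 -(rmorph_nat (GRing.in_alg K)) fmorph_eq0.
have toN P := nonsingular_reduction_of_nonsing Oover (W := W) (P := P).
have ofN P := nonsing_of_nonsingular_reduction Oover (W := W) (P := P).
have nD := nonsing_add Oval a1O a2O a3O a4O a6O.
have nN := @nonsing_opp _ _ Oval (wmap j (curve_of W)) a1O.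
split=> [|P Q /ofN nP /ofN nQ|P /ofN nP|a P /ofN nP].
- exact: toN.
- by apply: (toN); rewrite base_change_add; apply: (nD).
- by apply: (toN); rewrite base_change_opp; apply: (nN).
have [mor _ _] := endo a; have [Q eQ] := morphism_rational P mor.
exists Q => //; apply: (toN); rewrite eQ.
have wP : w \in Zadj_pred w.
  by apply/asboolP; exists 'X; rewrite map_polyX hornerX.
pose g : Zadj w := ZAdj wP.
have [t [n e]] := quadratic_order_eqn F_imq w_order.
pose N b := forall R, nonsing O R -> nonsing O (theta b R).
(* Integers, sums and products preserve [N], so only the generator needs the argument with its
   conjugate. *)
suff : N a by apply.
apply: (@Zadj_ind _ _ N g erefl).
- have gh : g + (t%:~R - g) = t%:~R by rewrite addrC subrK.
  (* The conjugate [t - w] satisfies [(t - w) w = n] by the quadratic equation of [w]. *)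
  have hg : (t%:~R - g) * g = n%:~R.
    apply: val_inj; change (Zadj_val ((t%:~R - g) * g) = Zadj_val (n%:~R : Zadj w)).
    rewrite Zadj_valM Zadj_valB !(rmorph_int (@Zadj_val K w)).
    by rewrite mulrBl -expr2 e subKr.
  exact: (nonsing_quadratic Oval m0 two0 a1O a2O a3O a4O a6O ell endo theta1
    thetaD thetaM gh hg).
- by move=> z R nR; apply: (theta_int ell theta1 thetaD _ nD nN).
- by move=> b c IHb IHc R nR; rewrite thetaD; apply: (nD); [exact: IHb|exact: IHc].
- by move=> b c IHb IHc R nR; rewrite thetaM; exact: (IHb _ (IHc _ nR)).
Qed.
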